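(* Let $n$ and $r$ be integers with $1\le r\le n-2$, let $I_r=\{\alpha\in\mathcal M_n:\operatorname{rank}(\alpha)\le r\}$, and let $\mathbb E(I_r)$ be the subsemigroup of $I_r$ generated by all idempotents of $I_r$. Then $$\mathbb E(I_r)=\{\operatorname{id}_A: A\subseteq[n]\text{ is cosparse and }|A|\le r\}\cup\{\alpha\in I_r:\operatorname{dom}(\alpha)\text{ and }\operatorname{codom}(\alpha)\text{ are non-cosparse}\}.$$ We have $\operatorname{rank}(\mathbb E(I_r))=\operatorname{idrank}(\mathbb E(I_r))=m(n,r)+m'(n,r-1)$.
   Context: For $n\ge0$ put $[n]=\{1,\dots,n\}$ and $[n]'=\{1',\dots,n'\}$ (disjoint copies). The partial Brauer monoid $\mathcal{PB}_n$ is the set of all set partitions of $[n]\cup[n]'$ into blocks of size at most $2$; an element is identified with the graph on $[n]\cup[n]'$ whose edges are its blocks of size $2$. Product: for $\alpha,\beta\in\mathcal{PB}_n$, rename each $i'$ of $\alpha$ to $i''$ and each $i$ of $\beta$ to $i''$, and let $\Gamma(\alpha,\beta)$ be the union of the two resulting graphs, on $[n]\cup[n]''\cup[n]'$. Then $\alpha\beta$ is the partition of $[n]\cup[n]'$ in which distinct $x,y$ form a block $\{x,y\}$ if and only if they are joined by a path in $\Gamma(\alpha,\beta)$, all other blocks being singletons. The Motzkin monoid $\mathcal M_n$ is the submonoid of planar elements of $\mathcal{PB}_n$, i.e. those whose graph can be drawn without crossings with vertices $1,\dots,n$ in a row from left to right, $i'$ directly below $i$, and all edges inside the rectangle determined by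 the vertices. A block is transversal if it meets both $[n]$ and $[n]'$; the rank of an element $\alpha$ is the number of transversal blocks of $\alpha$. $\operatorname{dom}(\alpha)$ is the set of $x\in[n]$ lying in a transversal block, and $\operatorname{codom}(\alpha)$ is the set of $x\in[n]$ such that $x'$ lies in a transversal block. For $A\subseteq[n]$, $\operatorname{id}_A$ is the element whose non-singleton blocks are exactly $\{a,a'\}$, $a\in A$. A subset $A\subseteq[n]$ is sparse if for all $i\in[n]$, $i\in A$ implies $i+1\notin A$; $A$ is cosparse if $[n]\setminus A$ is sparse. Let $D_r(\mathcal M_n)=\{\alpha\in\mathcal M_n:\operatorname{rank}(\alpha)=r\}$. For $\alpha\in\mathcal{PB}_n$, $\alpha^*$ is obtained by interchanging $i$ and $i'$ for every $i$; $\alpha$ is a projection if $\alpha^*=\alpha=\alpha^2$. An upper hook is a block of size $2$ contained in $[n]$. An upper nontransversal block $A\subseteq[n]$ of $\alpha$ is nested if there is an upper hook $\{x,y\}$ of $\alpha$ with $x<\min(A)\le\max(A)<y$, and unnested otherwise; nested lower blocks are defined analogously. $m(n,r)$ is the number of $\mathscr R$-classes of $\mathcal M_n$ contained in $D_r(\mathcal M_n)$, where $x\mathscr R y\iff x\mathcal M_n=y\mathcal M_n$; and $m'(n,r)$ is the number of projections in $D_r(\mathcal M_n)$ with no unnested singleton blocks. The rank of a semigroup $S$ is the least cardinality of a subset generating $S$ as a semigroup; if $S$ is generated by its idempotents, $\operatorname{idrank}(S)$ is the least cardinality of a set of idempotents generating $S$ as a semigroup. *)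

(* Defs.v *)
From mathcomp Require Import all_boot all_order all_algebra.

Set Implicit Arguments.
Unset Strict Implicit.
Unset Printing Implicit Defensive.

(** * Subsemigroups of a finite magma *)

Section Semigroups.

Variables (T : finType) (op : T -> T -> T).
Implicit Types (S A B : {set T}).

Definition mul_closed B := [forall x in B, forall y in B, op x y \in B].

Definition generated A : {set T} :=
  \bigcap_(B : {set T} | (A \subset B) && mul_closed B) B.

Definition idempotents S : {set T} := [set x in S | op x x == x].

Definition least_card (P : {set T} -> Prop) (k : nat) : Prop :=
  (exists2 A, P A & #|A| = k) /\ (forall A, P A -> k <= #|A|).

Definition is_rank S (k : nat) : Prop :=
  least_card (fun A => generated A = S) k.

Definition is_idrank S (k : nat) : Prop :=
  least_card (fun A => A \subset idempotents S /\ generated A = S) k.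

Definition right_mul x S : {set T} := [set op x y | y in S].

Definition Rclasses S : {set {set T}} :=
  equivalence_partition (fun x y => right_mul x S == right_mul y S) S.

End Semigroups.

(** * The partial Brauer monoid *)

(* [inl i] is the vertex i + 1 of the upper row, [inr i] is (i + 1)'. *)
Definition vertex (n : nat) : finType := ('I_n + 'I_n)%type.

Definition upper {n} (i : 'I_n) : vertex n := inl i.
Definition lower {n} (i : 'I_n) : vertex n := inr i.

(* The product below is defined on all families of blocks;
   it is the product of PB_n on the families in [partial_brauer n]. *)
Definition diagram (n : nat) : finType := {set {set vertex n}}.

Definition partial_brauer n : {set diagram n} :=
  [set a : diagram n | partition a [set: vertex n]
                       & [forall B in a, #|B| <= 2]].

Section Diagrams.

Variable n : nat.
Implicit Types (a b : diagram n) (B : {set vertex n}).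

Definition edges a : {set {set vertex n}} := [set B in a | #|B| == 2].

(* Vertices of the product graph: [inl x] for x in [n] or [n]', and [inr i]
   for the middle copy. *)
Definition product_vertex : finType := (vertex n + 'I_n)%type.

Definition glue_above (x : vertex n) : product_vertex :=
  match x with inl i => inl (upper i) | inr i => inr i end.

Definition glue_below (x : vertex n) : product_vertex :=
  match x with inl i => inr i | inr i => inl (lower i) end.

Definition product_graph a b : rel product_vertex := fun u v =>
  [exists x : vertex n, exists y : vertex n, (x != y) &&
     (  [&& [set x; y] \in edges a, u == glue_above x & v == glue_above y]
     || [&& [set x; y] \in edges b, u == glue_below x & v == glue_below y])].

Definition joined a b (x y : vertex n) : bool :=
  connect (product_graph a b) (inl x) (inl y).

Definition dmul a b : diagram n :=
     [set B | [exists x, exists y,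
                 [&& x != y, joined a b x y & B == [set x; y]]]]
 :|: [set [set x] | x : vertex n & [forall y, (x != y) ==> ~~ joined a b x y]].

Definition transversal_block B : bool :=
  [exists i, upper i \in B] && [exists i, lower i \in B].

Definition drank a : nat := #|[set B in a | transversal_block B]|.

Definition ddom a : {set 'I_n} :=
  [set i | [exists B in a, transversal_block B && (upper i \in B)]].

Definition dcodom a : {set 'I_n} :=
  [set i | [exists B in a, transversal_block B && (lower i \in B)]].

Definition did (A : {set 'I_n}) : diagram n :=
     [set [set upper i; lower i] | i in A]
 :|: [set [set upper i] | i in ~: A]
 :|: [set [set lower i] | i in ~: A].

Definition flip (x : vertex n) : vertex n :=
  match x with inl i => lower i | inr i => upper i end.

Definition dstar a : diagram n := [set flip @: B | B : {set vertex n} in a].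

Definition projection a : bool := (dstar a == a) && (a == dmul a a).

(* [side] is [upper] or [lower]. *)
Definition nested (side : 'I_n -> vertex n) a B : bool :=
  [exists x : 'I_n, exists y : 'I_n,
     ([set side x; side y] \in edges a) &&
     [forall i : 'I_n, (side i \in B) ==> (x < i < y)]].

Definition no_unnested_singletons a : bool :=
  [forall i : 'I_n,
     (([set upper i] \in a) ==> nested upper a [set upper i]) &&
     (([set lower i] \in a) ==> nested lower a [set lower i])].

Definition sparse (A : {set 'I_n}) : bool :=
  [forall i : 'I_n, forall j : 'I_n,
     (val j == i.+1) ==> (i \in A) ==> (j \notin A)].

Definition cosparse (A : {set 'I_n}) : bool := sparse (~: A).

End Diagrams.

(** * Planar drawings *)

(* Required only here: [classical_sets] shadows notions of [finset]. *)
From mathcomp Require Import boolp classical_sets reals topology normedtype.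
From mathcomp Require Import finset.
Import numFieldNormedType.Exports.

Section Planarity.

Local Open Scope ring_scope.

Variables (R : realType) (n : nat).

Definition position (x : vertex n) : R * R :=
  match x with inl i => ((i : nat)%:R, 1) | inr i => ((i : nat)%:R, 0) end.

Definition in_rectangle (p : R * R) : Prop :=
  (0 <= p.1 <= n.-1%:R) /\ (0 <= p.2 <= 1).

(* [f] draws the edge [B] as a simple arc that stays in the rectangle and meets
   the vertices only at its two endpoints. *)
Definition draws (f : R -> R * R) (B : {set vertex n}) : Prop :=
  [/\ {within `[0, 1], continuous f}%classic,
      {in `[0, 1] &, injective f},
      exists x y, [/\ B = [set x; y], f 0 = position x & f 1 = position y],
      {in `[0, 1], forall t, in_rectangle (f t)} &
      {in `]0, 1[, forall t x, f t <> position x}].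

Definition planar (a : diagram n) : Prop :=
  exists arc : {set vertex n} -> R -> R * R,
    (forall B, B \in edges a -> draws (arc B) B) /\
    (forall B C, B \in edges a -> C \in edges a -> B != C ->
       {in `[0, 1] &, forall s t, arc B s <> arc C t}).

End Planarity.

(** * The Motzkin monoid *)

Section Motzkin.

Variables (R : realType) (n : nat).

Definition motzkin : {set diagram n} :=
  [set a in partial_brauer n | `[< planar R a >]].

Definition motzkin_D (r : nat) : {set diagram n} :=
  [set a in motzkin | drank a == r].

Definition motzkin_I (r : nat) : {set diagram n} :=
  [set a in motzkin | drank a <= r].

Definition motzkin_E (r : nat) : {set diagram n} :=
  generated (@dmul n) (idempotents (@dmul n) (motzkin_I r)).

Definition num_Rclasses (r : nat) : nat :=
  #|[set C in Rclasses (@dmul n) motzkin | C \subset motzkin_D r]|.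

Definition num_projections (r : nat) : nat :=
  #|[set a in motzkin_D r | projection a & no_unnested_singletons a]|.

End Motzkin.

(* Main.v *)
(** A block structure on [[n]] and [[n]'] is handled as the involution [partner]
    exchanging the elements of each block of size 2.

    Planarity.  For a drawn pair of edges, the parity [crossing] depends only on the
    endpoints.  Curves [f] and [g] without common point make [(s, t) |-> f s - g t] a
    nowhere zero map on the square, and counting the sign changes of its coordinates
    along the boundary of a fine grid, in the manner of Sperner, shows that this
    parity is even; conversely, shallow parabolas for the hooks and straight lines
    for the transversals realise every noncrossing diagram.  As [crossing] is bilinear
    modulo 2 in the edges, it is additive along the paths of the product graph, so
    that products of noncrossing diagrams are noncrossing.

    Structure.  A noncrossing diagram is determined by its upper and lower
    nontransversal blocks, two of them are R-related if and only if their upper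
    nontransversal blocks agree, and each R-class contains exactly one projection.
    An idempotent whose domain is cosparse has no hook, hence is a partial identity.

    Generation.  The projections of rank [r], with those of rank [r - 1] without
    unnested singletons, generate: the link (U D T)(T U D), with padding zeros, moves a
    transversal over two or three free columns, and such moves connect all the
    noncosparse domains of the same rank; projections of smaller rank are reached by
    opening hooks or singletons into transversals and closing them again.  Each of
    these generators is needed because a product [y z] in its R-class forces [y] into
    this R-class. *)

Require Import Defs.
From mathcomp Require Import all_boot reals.
From mathcomp Require Import perm boolp zify finset.
From mathcomp Require all_order all_algebra classical_sets lra ring.
From mathcomp Require interval_inference prodnormedzmodule topology normedtype.
From mathcomp Require sequences.

Set Implicit Arguments.
Unset Strict Implicit.
Unset Printing Implicit Defensive.

(** * Diagrams as involutions *)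

(** Both summands of the rank come from one observation. If a product has exactly one transversal
    fewer than its first factor, the lost upper end becomes a singleton, and no hook covers it: such
    a hook would already belong to the first factor, where a hook cannot enclose the end of a
    transversal. So a projection of rank [r - 1] whose singletons are all nested has no
    factorisation with first factor of rank [r], even up to its R-class. Two ranks below the top
    this obstruction is gone: two transversals can be lost together by joining them to a hook, and
    no further generators arise. Moving a transversal needs room, since it travels along two hooks
    that meet in a middle column and thus passes at least two free columns. A domain without two
    adjacent free columns admits no such move; this is why cosparse domains carry only partial
    identities, while all other domains of one rank are connected. The connecting elements may have
    arbitrary hooks, because projections multiplied on both sides prescribe the outer blocks. *)

Section Partners.

Variable n : nat.
Implicit Types (a b : diagram n) (x y : vertex n) (i j : 'I_n).

(** The default makes a singleton its own partner, so that [[set x; partner a x]] is the block of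
    [x] in every case. *)
Definition partner a x : vertex n :=
  odflt x [pick y | (x != y) && ([set x; y] \in a)].

Definition diagram_of (s : vertex n -> vertex n) : diagram n :=
  [set [set x; s x] | x : vertex n].

Lemma eq_set2 (T : finType) (x y z : T) : [set x; y] = [set x; z] -> y = z.
Proof.
move=> e; have := set22 x y; rewrite e !inE => /orP[/eqP yx|/eqP //].
by have := set22 x z; rewrite -e !inE yx orbb => /eqP->.
Qed.

Lemma partner_eq a x y :
  a \in partial_brauer n -> [set x; y] \in a -> partner a x = y.
Proof.
rewrite inE => /andP[/and3P[_ /trivIsetP tI _] _] xya.
have uniq_block C : C \in a -> x \in C -> C = [set x; y].
  move=> Ca xC; apply/eqP; apply: contraT => nC.
  by have /pred0P/(_ x) := tI _ _ Ca xya nC; rewrite /= xC !inE eqxx.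
rewrite /partner; case: pickP => [z /andP[xz xza]|none] /=.
  by have /eq_set2 := uniq_block _ xza (set21 _ _).
by have := none y; rewrite xya andbT; case: eqP.
Qed.

Lemma mem_partner a x : a \in partial_brauer n -> [set x; partner a x] \in a.
Proof.
move=> aP; move: (aP); rewrite inE => /andP[/and3P[/eqP cov _ _] /forall_inP sz].
have: x \in cover a by rewrite cov inE.
case/bigcupP=> B Ba xB.
suff [y Bxy] : exists y, B = [set x; y] by move: Ba; rewrite Bxy => /[dup] /(partner_eq aP) ->.
have szB := sz _ Ba.
case: (set_0Vmem (B :\ x)) => [B0|[y]].
  by exists x; rewrite -(setD1K xB) B0 setU0 setUid.
rewrite !inE => /andP[yx yB]; exists y.
apply/esym/eqP; rewrite eqEcard cards2 eq_sym yx szB andbT.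
by apply/subsetP=> z; rewrite !inE => /orP[] /eqP->.
Qed.

Lemma partnerK a : a \in partial_brauer n -> involutive (partner a).
Proof. by move=> aP x; apply: partner_eq => //; rewrite setUC mem_partner. Qed.

Lemma partner_swap a x y :
  a \in partial_brauer n -> partner a x = y -> partner a y = x.
Proof. by move=> aP <-; apply: partnerK. Qed.

Lemma mem_block a x y :
  a \in partial_brauer n -> ([set x; y] \in a) = (partner a x == y).
Proof.
move=> aP; apply/idP/eqP => [|<-]; [exact: partner_eq|exact: mem_partner].
Qed.

Lemma mem_singleton a x :
  a \in partial_brauer n -> ([set x] \in a) = (partner a x == x).
Proof. by move=> aP; rewrite -mem_block // setUid. Qed.

Lemma blockP a (B : {set vertex n}) : a \in partial_brauer n ->
  reflect (exists x, B = [set x; partner a x]) (B \in a).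
Proof.
move=> aP; apply: (iffP idP) => [Ba|[x ->]]; last exact: mem_partner.
move: (aP); rewrite inE => /andP[/and3P[_ /trivIsetP tI n0] _].
case: (set_0Vmem B) Ba n0 => [->|[x xB] Ba _]; first by move=> ->.
exists x; apply/eqP; apply: contraT => nB.
by have /pred0P/(_ x) := tI _ _ Ba (mem_partner x aP) nB; rewrite /= xB !inE eqxx.
Qed.

Lemma diagram_ofK a : a \in partial_brauer n -> diagram_of (partner a) = a.
Proof.
move=> aP; apply/setP=> B.
by apply/imsetP/blockP => // -[x]; [move=> _ ->; exists x|move=> ->; exists x].
Qed.

Lemma eq_diagram a b : a \in partial_brauer n -> b \in partial_brauer n ->
  partner a =1 partner b -> a = b.
Proof.
move=> aP bP eab; rewrite -(diagram_ofK aP) -(diagram_ofK bP).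
by apply: eq_imset => x; rewrite eab.
Qed.

Lemma diagram_of_pb s : involutive s -> diagram_of s \in partial_brauer n.
Proof.
move=> sK; have sym x y : x \in [set y; s y] -> [set y; s y] = [set x; s x].
  by rewrite !inE => /orP[] /eqP-> //; rewrite sK setUC.
rewrite inE; apply/andP; split; last first.
  by apply/forall_inP=> _ /imsetP[x _ ->]; rewrite cards2; case: eqP.
apply/and3P; split.
- rewrite eqEsubset subsetT; apply/subsetP=> x _.
  by apply/bigcupP; exists [set x; s x]; [exact: imset_f|rewrite !inE eqxx].
- apply/trivIsetP=> _ _ /imsetP[x _ ->] /imsetP[y _ ->]; apply: contraR.
  by case/pred0Pn=> z /andP[/= /sym-> /sym->].
- by apply/imsetP=> -[x _ e]; have := set21 x (s x); rewrite -e inE.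
Qed.

Lemma partner_diagram_of s : involutive s -> partner (diagram_of s) =1 s.
Proof.
by move=> sK x; apply: partner_eq (diagram_of_pb sK) _; apply: imset_f.
Qed.

Lemma mem_edges a x y : a \in partial_brauer n ->
  ([set x; y] \in edges a) = (x != y) && (partner a x == y).
Proof. by move=> aP; rewrite inE mem_block // cards2 andbC; case: (x == y). Qed.

Definition is_upper x := if x is inl _ then true else false.
Definition column x : 'I_n := match x with inl i => i | inr i => i end.

Lemma upper_column x : is_upper x -> x = upper (column x).
Proof. by case: x. Qed.

Lemma lower_column x : ~~ is_upper x -> x = lower (column x).
Proof. by case: x. Qed.

Lemma is_upper_flip x : is_upper (flip x) = ~~ is_upper x.
Proof. by case: x. Qed.

Lemma flipK : involutive (@flip n).
Proof. by case. Qed.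

Lemma transversalE x y :
  transversal_block [set x; y] = (is_upper x != is_upper y).
Proof.
apply/andP/idP => [[/existsP[i] + /existsP[j]]|].
  by case: x => x; case: y => y; rewrite !inE.
by case: x => x; case: y => y //= _; split; apply/existsP;
  [exists x|exists y|exists y|exists x]; rewrite !inE ?eqxx ?orbT.
Qed.

Lemma mem_ddom a i : a \in partial_brauer n ->
  (i \in ddom a) = ~~ is_upper (partner a (upper i)).
Proof.
move=> aP; rewrite inE; apply/exists_inP/idP => [[B /(blockP _ aP)[x ->]]|nu].
  rewrite transversalE !inE => /andP[+ /orP[] /eqP e]; rewrite -e /=.
    by case: is_upper.
  by rewrite (partner_swap aP (esym e)); case: is_upper.
exists [set upper i; partner a (upper i)]; first exact: mem_partner.
by rewrite transversalE !inE eqxx /= andbT; case: is_upper nu.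
Qed.

Lemma mem_dcodom a i : a \in partial_brauer n ->
  (i \in dcodom a) = is_upper (partner a (lower i)).
Proof.
move=> aP; rewrite inE; apply/exists_inP/idP => [[B /(blockP _ aP)[x ->]]|nu].
  rewrite transversalE !inE => /andP[+ /orP[] /eqP e]; rewrite -e /=.
    by case: is_upper.
  by rewrite (partner_swap aP (esym e)); case: is_upper.
exists [set lower i; partner a (lower i)]; first exact: mem_partner.
by rewrite transversalE !inE eqxx /= andbT; case: is_upper nu.
Qed.

Lemma ddomP a i : a \in partial_brauer n ->
  reflect (exists j, partner a (upper i) = lower j) (i \in ddom a).
Proof.
move=> aP; rewrite mem_ddom //; apply: (iffP idP) => [/lower_column ->|[j -> //]].
by exists (column (partner a (upper i))).
Qed.

Lemma dcodomP a i : a \in partial_brauer n ->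
  reflect (exists j, partner a (lower i) = upper j) (i \in dcodom a).
Proof.
move=> aP; rewrite mem_dcodom //; apply: (iffP idP) => [/upper_column ->|[j -> //]].
by exists (column (partner a (lower i))).
Qed.

Lemma not_ddomP a i : a \in partial_brauer n ->
  reflect (exists j, partner a (upper i) = upper j) (i \notin ddom a).
Proof.
move=> aP; rewrite mem_ddom // negbK.
apply: (iffP idP) => [/upper_column ->|[j -> //]].
by exists (column (partner a (upper i))).
Qed.

Lemma drankE a : a \in partial_brauer n -> drank a = #|ddom a|.
Proof.
move=> aP; rewrite /drank.
pose f i := [set upper i; partner a (upper i)].
have -> : [set B in a | transversal_block B] = f @: ddom a.
  apply/setP=> B; rewrite inE; apply/andP/imsetP => [[/(blockP _ aP)[x ->]]|].
    rewrite transversalE; case: x => i /= tr.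
      by exists i => //; rewrite mem_ddom //; case: is_upper tr.
    have : i \in dcodom a by rewrite mem_dcodom //; case: is_upper tr.
    case/(dcodomP _ aP)=> k ek; have ei := partner_swap aP ek.
    by exists k; [apply/(ddomP _ aP); exists i|rewrite /f ei ek setUC].
  case=> i; rewrite mem_ddom // => nu ->; split; first exact: mem_partner.
  by rewrite transversalE; case: is_upper nu.
rewrite card_in_imset // => i j _ jd e.
have : upper i \in f j by rewrite -e !inE eqxx.
rewrite !inE => /orP[/eqP[] //|/eqP eij].
by move: jd; rewrite mem_ddom // -eij.
Qed.

Lemma starE a : a \in partial_brauer n ->
  dstar a = diagram_of (fun x => flip (partner a (flip x))).
Proof.
move=> aP; apply/setP=> B.
apply/imsetP/imsetP=> [[C /(blockP _ aP)[y ->] ->]|[y _ ->]].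
  by exists (flip y) => //; rewrite flipK imsetU !imset_set1.
exists [set flip y; partner a (flip y)]; first exact: mem_partner.
by rewrite imsetU !imset_set1 flipK.
Qed.

Let star_inv a : a \in partial_brauer n ->
  involutive (fun x => flip (partner a (flip x))).
Proof. by move=> aP x; rewrite flipK partnerK // flipK. Qed.

Lemma partner_star a x : a \in partial_brauer n ->
  partner (dstar a) x = flip (partner a (flip x)).
Proof. by move=> aP; rewrite starE // partner_diagram_of //; apply: star_inv. Qed.

Lemma star_pb a : a \in partial_brauer n -> dstar a \in partial_brauer n.
Proof. by move=> aP; rewrite starE //; apply/diagram_of_pb/star_inv. Qed.

Lemma starK a : a \in partial_brauer n -> dstar (dstar a) = a.
Proof.
move=> aP; apply: eq_diagram; rewrite ?star_pb // => x.
by rewrite !partner_star ?star_pb // !flipK.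
Qed.

Lemma dom_star a : a \in partial_brauer n -> ddom (dstar a) = dcodom a.
Proof.
move=> aP; apply/setP=> i.
by rewrite mem_ddom ?star_pb // mem_dcodom // partner_star // is_upper_flip negbK.
Qed.

Lemma codom_star a : a \in partial_brauer n -> dcodom (dstar a) = ddom a.
Proof. by move=> aP; rewrite -{2}(starK aP) dom_star // star_pb. Qed.

Lemma card_dom_codom a : a \in partial_brauer n -> #|ddom a| = #|dcodom a|.
Proof.
have le b : b \in partial_brauer n -> #|ddom b| <= #|dcodom b|.
  move=> bP; pose f i := column (partner b (upper i)).
  have fE i : i \in ddom b -> partner b (upper i) = lower (f i).
    by rewrite mem_ddom // /f => /lower_column{1}->.
  rewrite -(@card_in_imset _ _ f) => [|i j /fE ei /fE ej eij].
    apply/subset_leq_card/subsetP=> _ /imsetP[i /fE ei ->].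
    by apply/(dcodomP _ bP); exists i; apply: partner_swap.
  suff [] : upper i = upper j by [].
  by apply: (can_inj (partnerK bP)); rewrite ei ej eij.
move=> aP; apply/eqP; rewrite eqn_leq le //=.
by rewrite -codom_star // -dom_star // le ?star_pb.
Qed.

End Partners.

(** * Products *)

Section Product.

Variable n : nat.
Implicit Types (x y : vertex n) (i j : 'I_n).

(* An incidence [(x, s)] is the vertex [x] of the upper factor if [s] and of the
   lower factor otherwise; [turn] identifies the two copies of the middle row. *)
Definition incidence : finType := (vertex n * bool)%type.

Definition turn (h : incidence) : incidence :=
  match h with
  | (inr i, true) => (inl i, false)
  | (inl i, false) => (inr i, true)
  | _ => h
  end.

(** The upper row of the product stems from the upper factor and the lower row from the lower one,
    so [is_upper] is the tag of the factor. *)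
Definition outer x : incidence := (x, is_upper x).

Definition incidence_vertex (h : incidence) : product_vertex n :=
  if h.2 then glue_above h.1 else glue_below h.1.

Lemma turnK : involutive turn.
Proof. by case=> [[] i []]. Qed.

Lemma turn_outer x : turn (outer x) = outer x.
Proof. by case: x. Qed.

Lemma turn_fixedP h : reflect (exists x, h = outer x) (turn h == h).
Proof.
apply: (iffP eqP) => [|[x ->]]; last exact: turn_outer.
by case: h => [[] i []] // _; [exists (upper i)|exists (lower i)].
Qed.

Lemma incidence_vertex_turn h : incidence_vertex (turn h) = incidence_vertex h.
Proof. by case: h => [[] i []]. Qed.

Lemma incidence_vertex_eq h k :
  incidence_vertex h = incidence_vertex k -> k = h \/ k = turn h.
Proof.
by case: h => [[] i []]; case: k => [[] j []] //= [->]; auto.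
Qed.

Variables (a b : diagram n).
Hypotheses (aP : a \in partial_brauer n) (bP : b \in partial_brauer n).

Definition cross (h : incidence) : incidence :=
  (partner (if h.2 then a else b) h.1, h.2).

Lemma crossK : involutive cross.
Proof. by case=> x []; rewrite /cross /= partnerK. Qed.

(** A composition of two involutions. [cross] follows an edge of one factor, [turn] changes the
    factor at a middle vertex. At an outer end [turn] does nothing, and at a singleton [cross] does
    nothing, so the walk runs back along the same path. *)
Definition advance (h : incidence) := turn (cross h).

Lemma advance_inj : injective advance.
Proof. by apply: inj_comp (can_inj turnK) (can_inj crossK). Qed.

Lemma product_graphP u v : reflect
  (exists h, [/\ u = incidence_vertex h, v = incidence_vertex (cross h)
               & cross h != h])
  (product_graph a b u v).
Proof.
apply: (iffP existsP) => [[x /existsP[y]]|[[x s] [-> -> ne]]].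
  case/andP=> xy /orP[] /and3P[+ /eqP-> /eqP->]; rewrite mem_edges // => /andP[_ /eqP e].
    by exists (x, true); split; rewrite /cross /= ?e // xpair_eqE eqxx andbT eq_sym.
  by exists (x, false); split; rewrite /cross /= ?e // xpair_eqE eqxx andbT eq_sym.
exists x; apply/existsP; exists (cross (x, s)).1.
move: ne; rewrite xpair_eqE eqxx andbT eq_sym => ne; rewrite ne /=.
by rewrite !mem_edges // !ne /=; case: s {ne}; rewrite /incidence_vertex /= !eqxx ?orbT.
Qed.

(** If [h'] is reached after [k] steps, then [turn (advance h') = cross h'] lies one step before
    [turn h']. The claim thus descends to [outer x], which [turn] fixes. *)
Lemma fconnect_turn x h :
  fconnect advance (outer x) h -> fconnect advance (outer x) (turn h).
Proof.
move=> /iter_findex <-; elim: (findex _ _ _) => [|k IH]; first by rewrite turn_outer.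
rewrite iterS {1}/advance turnK; set h' := iter _ _ _ in IH *.
apply: connect_trans IH _; rewrite (fconnect_sym advance_inj).
have -> : turn h' = advance (cross h') by rewrite /advance crossK.
exact: fconnect1.
Qed.

Lemma fconnect_cross x h :
  fconnect advance (outer x) h -> fconnect advance (outer x) (cross h).
Proof.
move=> xh; have := fconnect_turn (connect_trans xh (fconnect1 _ _)).
by rewrite /advance turnK.
Qed.

(** Being closed under [turn] and [cross], the orbit of [outer x] contains all incidences of the
    component of [x]. *)
Lemma joinedP x y :
  reflect (fconnect advance (outer x) (outer y)) (joined a b x y).
Proof.
have end_vertex z : incidence_vertex (outer z) = inl z by case: z.
apply: (iffP idP) => [|/iter_findex yk].
  rewrite /joined => xy.
  suff orbit u : connect (product_graph a b) (inl x) u ->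
      forall h, incidence_vertex h = u -> fconnect advance (outer x) h.
    by apply: orbit xy _ _.
  case/connectP=> p + ->; elim/last_ind: p => [_ h|p v IH].
    rewrite -end_vertex => /esym/incidence_vertex_eq[] ->; first exact: connect0.
    exact/fconnect_turn/connect0.
  rewrite rcons_path last_rcons => /andP[/IH{}IH /product_graphP[h [eu -> _]]] k.
  move/esym/incidence_vertex_eq=> [] ->; last apply: fconnect_turn;
    by apply/fconnect_cross/IH.
rewrite /joined -!end_vertex -yk; elim: (findex _ _ _) => [|k IH] //=.
rewrite incidence_vertex_turn; case: (eqVneq (cross (iter k advance (outer x))) (iter k advance (outer x))) => [->//|ne].
apply: connect_trans IH (connect1 _).
by apply/product_graphP; exists (iter k advance (outer x)).
Qed.

(** [turn] conjugates [advance] to its inverse and fixes [outer x]. *)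
Lemma iter_advance_turn k x :
  iter k advance (turn (iter k advance (outer x))) = outer x.
Proof.
elim: k => [|k IH]; first exact: turn_outer.
rewrite [in turn _]iterS iterSr {2}/advance turnK.
by rewrite -[X in _ = X]IH /advance crossK.
Qed.

Lemma order_dvd k x : iter k advance (outer x) = outer x ->
  order advance (outer x) %| k.
Proof.
move=> e; rewrite /dvdn; set m := order _ _.
have em : iter m advance (outer x) = outer x by apply: iter_order advance_inj _.
have emq q : iter (q * m) advance (outer x) = outer x.
  by elim: q => // q IH; rewrite mulSn iterD IH.
have lt : k %% m < m by rewrite ltn_mod order_gt0.
have := @findex_iter _ advance _ _ lt.
have -> : iter (k %% m) advance (outer x) = outer x.
  by rewrite -{2}e {2}(divn_eq k m) addnC iterD emq.
by rewrite findex0 => <-.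
Qed.

(* Walking on from a second endpoint [y], reached after [k] steps, leads back to
   [x] in [k] more steps, while a dead end reached after [k] steps leads back to
   [x] in [k + 1] more steps: the parity of the orbit tells them apart. *)
Lemma joined_order x y : joined a b x y -> x != y ->
  exists2 k, k.*2 = order advance (outer x) & outer y = iter k advance (outer x).
Proof.
move=> /joinedP xy ne; set k := findex advance (outer x) (outer y).
have yk : iter k advance (outer x) = outer y by apply: iter_findex.
exists k => //; have := iter_advance_turn k x; rewrite yk turn_outer -yk -iterD.
move/order_dvd/dvdnP=> [[|[|q]]].
- rewrite mul0n => /eqP; rewrite addn_eq0 andbb => /eqP k0.
  by move: yk ne; rewrite k0 /= => -[->]; rewrite eqxx.
- by rewrite mul1n addnn.
- have lt : k < order advance (outer x) by apply: findex_max.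
  move=> e; suff : k + k < k + k by rewrite ltnn.
  rewrite {2}e !mulSn addnA; apply: leq_trans (leq_addr _ _).
  by rewrite -addnS leq_add // ltnW.
Qed.

(** Either end is reached after exactly half of the orbit of [outer x]. *)
Lemma joined_uniq x y z : joined a b x y -> joined a b x z ->
  x != y -> x != z -> y = z.
Proof.
move=> xy xz /(joined_order xy)[k ek yk] /(joined_order xz)[l el zl].
have /double_inj kl : k.*2 = l.*2 by rewrite ek el.
by move: zl; rewrite -kl -yk => -[->].
Qed.

Lemma joined_dead x y h : fconnect advance (outer x) h -> cross h = h ->
  joined a b x y -> x = y.
Proof.
move=> /iter_findex; set k := findex _ _ _ => hk dead xy.
apply/eqP; apply: contraT => /(joined_order xy)[l ol _].
have : odd (order advance (outer x)).
  (* The extra step is [advance h = turn h] at the dead end; then [k] steps lead back. *)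
  have : order advance (outer x) %| k.+1 + k.
    apply: order_dvd; rewrite iterD hk -{1}dead -(turnK (cross h)) -/(advance h).
    by rewrite -{1}hk -iterS iter_advance_turn.
  by move/dvdn_odd; apply; rewrite addSn addnn /= odd_double.
by rewrite -ol odd_double.
Qed.

Lemma joined_sym x y : joined a b x y = joined a b y x.
Proof. by apply/joinedP/joinedP; rewrite (fconnect_sym advance_inj). Qed.

Definition product_partner x : vertex n :=
  odflt x [pick y | (x != y) && joined a b x y].

Lemma product_partnerE x y : joined a b x y -> x != y -> product_partner x = y.
Proof.
move=> xy ne; rewrite /product_partner; case: pickP => [z /andP[xz jz]|/(_ y)] /=.
  exact: joined_uniq jz xy xz ne.
by rewrite ne xy.
Qed.

Lemma product_partner_id x :
  (forall y, joined a b x y -> x = y) -> product_partner x = x.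
Proof.
move=> none; rewrite /product_partner; case: pickP => [z /andP[xz /none e]|] //=.
Qed.

Lemma product_partnerP x : joined a b x (product_partner x).
Proof.
rewrite /product_partner; case: pickP => [z /andP[]|] //= _.
exact: connect0.
Qed.

Lemma product_partnerK : involutive product_partner.
Proof.
move=> x; have := product_partnerP x; case: (eqVneq (product_partner x) x) => [e|].
  by rewrite !e.
by rewrite joined_sym => ne xy; apply: product_partnerE xy ne.
Qed.

Lemma dmulE : dmul a b = diagram_of product_partner.
Proof.
apply/setP=> B; apply/setUP/imsetP => [[]|[x _ ->]].
- rewrite inE => /existsP[x /existsP[y /and3P[xy jxy /eqP ->]]].
  by exists x => //; rewrite (product_partnerE jxy xy).
- case/imsetP=> x; rewrite inE => /forall_inP none ->; exists x => //.
  rewrite product_partner_id ?setUid // => y jxy.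
  by apply/eqP; apply: contraT => /none; rewrite jxy.
case: (eqVneq x (product_partner x)) => [e|ne]; [right|left].
  rewrite -e setUid; apply/imsetP; exists x => //; rewrite inE.
  apply/forall_inP=> y xy; apply/negP=> jxy.
  by have := xy; rewrite -(product_partnerE jxy xy) -e eqxx.
rewrite inE; apply/existsP; exists x; apply/existsP; exists (product_partner x).
by rewrite ne product_partnerP eqxx.
Qed.

Lemma dmul_pb : dmul a b \in partial_brauer n.
Proof. by rewrite dmulE diagram_of_pb //; apply: product_partnerK. Qed.

Lemma partner_dmul : partner (dmul a b) =1 product_partner.
Proof. by rewrite dmulE; apply/partner_diagram_of/product_partnerK. Qed.

End Product.

(** * Blocks of a product obtained from short explicit paths *)

Section Paths.

Variable n : nat.
Implicit Types (a b : diagram n) (x y : vertex n) (i j k l m : 'I_n).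

(** The reflection [f] exchanges the factors and conjugates one walk to the other. *)
Lemma star_joined a b x y : a \in partial_brauer n -> b \in partial_brauer n ->
  joined a b x y -> joined (dstar b) (dstar a) (flip x) (flip y).
Proof.
move=> aP bP /(joinedP aP bP)/iter_findex yk; apply/joinedP; rewrite ?star_pb //.
pose f (h : incidence n) : incidence n := (flip h.1, ~~ h.2).
have f_outer z : outer (flip z) = f (outer z) by case: z.
have f_advance h : advance (dstar b) (dstar a) (f h) = f (advance a b h).
  rewrite /advance; have -> : cross (dstar b) (dstar a) (f h) = f (cross a b h).
    by case: h => z []; rewrite /cross /= partner_star ?flipK.
  by case: (cross a b h) => [[] i []].
rewrite !f_outer -yk; elim: (findex _ _ _) => [|m IH]; first exact: connect0.
by rewrite iterS -f_advance; apply: connect_trans IH (fconnect1 _ _).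
Qed.

Lemma dmul_star a b : a \in partial_brauer n -> b \in partial_brauer n ->
  dmul (dstar b) (dstar a) = dstar (dmul a b).
Proof.
move=> aP bP; have abP := dmul_pb aP bP.
apply: eq_diagram => [||x]; rewrite ?dmul_pb ?star_pb //.
rewrite partner_star // !partner_dmul ?star_pb //.
case: (eqVneq (product_partner a b (flip x)) (flip x)) => [e|ne].
  rewrite e flipK; apply: product_partner_id; rewrite ?star_pb // => y.
  move/(star_joined (star_pb bP) (star_pb aP)); rewrite !starK // => j.
  apply/eqP; apply: contraT => xy; have ne' : flip x != flip y.
    by rewrite (inj_eq (can_inj (@flipK n))).
  by move: (product_partnerE aP bP j ne'); rewrite e => /eqP; rewrite (negPf ne').
apply: product_partnerE; rewrite ?star_pb //; last first.
  by rewrite -(inj_eq (can_inj (@flipK n))) flipK eq_sym.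
by rewrite -{1}[x]flipK; apply: star_joined => //; apply: product_partnerP.
Qed.

Section Fixed.

Variables (a b : diagram n).
Hypotheses (aP : a \in partial_brauer n) (bP : b \in partial_brauer n).

Let reach x h := fconnect (advance a b) (outer x) h.

Let partner_reach x y : reach x (outer y) -> x != y -> partner (dmul a b) x = y.
Proof. by move=> /(joinedP aP bP); rewrite partner_dmul //; apply: product_partnerE. Qed.

Let partner_dead x h : reach x h -> cross a b h = h -> partner (dmul a b) x = x.
Proof.
move=> xh dead; rewrite partner_dmul //; apply: product_partner_id => // y.
exact: joined_dead xh dead.
Qed.

Let reach_upper i x : partner a (upper i) = x -> reach (upper i) (x, true).
Proof.
by move=> <-; apply: (fconnect_cross (h := outer (upper i)) aP bP); apply: connect0.
Qed.

Let reach_below x j y : reach x (lower j, true) -> partner b (upper j) = y ->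
  reach x (y, false).
Proof.
by move=> xj <-; apply: (fconnect_cross (h := turn _) aP bP (fconnect_turn aP bP xj)).
Qed.

Let reach_above x j y : reach x (upper j, false) -> partner a (lower j) = y ->
  reach x (y, true).
Proof.
by move=> xj <-; apply: (fconnect_cross (h := turn _) aP bP (fconnect_turn aP bP xj)).
Qed.

Lemma dmul_upper i j :
  partner a (upper i) = upper j -> partner (dmul a b) (upper i) = upper j.
Proof.
case: (eqVneq i j) => [<- e|ne /reach_upper]; last first.
  by move/partner_reach; apply; apply: contra_neq ne => -[].
by apply: partner_dead (connect0 _ _) _; rewrite /cross /= e.
Qed.

Lemma dmul_transversal i j k :
  partner a (upper i) = lower j -> partner b (upper j) = lower k ->
  partner (dmul a b) (upper i) = lower k.
Proof. by move=> /reach_upper/reach_below/[apply]/partner_reach; apply. Qed.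

Lemma dmul_hook i j k l :
  partner a (upper i) = lower j -> partner b (upper j) = upper k ->
  partner a (lower k) = upper l -> partner (dmul a b) (upper i) = upper l.
Proof.
move=> ij jk kl; have ik := reach_below (reach_upper ij) jk.
(* The ends agree only if [k = j], that is, if [j] is an upper singleton of [b] and the path is a
   dead end. *)
case: (eqVneq i l) => [il|ne].
  move: (kl); rewrite -il => /(partner_swap aP); rewrite ij => -[kj].
  by apply: partner_dead ik _; rewrite /cross /= -{1}kj jk.
by apply: partner_reach (reach_above ik kl) _; apply: contra_neq ne => -[].
Qed.

Lemma dmul_dead i j k :
  partner a (upper i) = lower j -> partner b (upper j) = upper k ->
  partner a (lower k) = lower k -> partner (dmul a b) (upper i) = upper i.
Proof.
move=> ij jk kk; have ik := reach_above (reach_below (reach_upper ij) jk) kk.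
by apply: partner_dead ik _; rewrite /cross /= kk.
Qed.

Lemma dmul_zigzag i j k l m :
  partner a (upper i) = lower j -> partner b (upper j) = upper k ->
  partner a (lower k) = lower l -> partner b (upper l) = lower m ->
  partner (dmul a b) (upper i) = lower m.
Proof.
move=> ij jk kl lm; apply: partner_reach => //.
exact: reach_below (reach_above (reach_below (reach_upper ij) jk) kl) lm.
Qed.

End Fixed.

Lemma dmul_lower a b i j : a \in partial_brauer n -> b \in partial_brauer n ->
  partner b (lower i) = lower j -> partner (dmul a b) (lower i) = lower j.
Proof.
move=> aP bP e; have := @dmul_upper _ _ (star_pb bP) (star_pb aP) i j.
rewrite dmul_star // !partner_star ?dmul_pb //= e => /(_ erefl).
by move/(congr1 (@flip n)); rewrite flipK.
Qed.

Lemma dmul_lower_hook a b i j k l :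
  a \in partial_brauer n -> b \in partial_brauer n ->
  partner b (lower i) = upper j -> partner a (lower j) = lower k ->
  partner b (upper k) = lower l -> partner (dmul a b) (lower i) = lower l.
Proof.
move=> aP bP e1 e2 e3; have := @dmul_hook _ _ (star_pb bP) (star_pb aP) i j k l.
rewrite dmul_star // !partner_star ?dmul_pb //= e1 e2 e3 => /(_ erefl erefl erefl).
by move/(congr1 (@flip n)); rewrite flipK.
Qed.

End Paths.

(** * Crossing parity *)

(** Without fixed points, [s] splits the sum modulo 2 into pairs that cancel. *)
Lemma addb_involution (T : finType) (A : {set T}) (s : T -> T) (F : T -> bool) :
  involutive s -> {in A, forall h, s h \in A} -> {in A, forall h, s h != h} ->
  {in A, forall h, F (s h) = F h} -> \big[addb/false]_(h in A) F h = false.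
Proof.
move=> sK; have [m] := ubnP #|A|; elim: m A => // m IH A ltA sA nA FA.
case: (set_0Vmem A) => [->|[h hA]]; first by rewrite big_set0.
have shA : s h \in A :\ h by rewrite !inE nA // sA.
rewrite (big_setD1 h) //= (big_setD1 (s h)) //= FA // addKb.
apply: IH => [|k|k|k]; rewrite ?inE.
- by move: ltA; rewrite (cardsD1 h) hA (cardsD1 (s h)) shA !add1n ltnS; apply: ltnW.
- case/and3P=> ksh kh kA; rewrite (inj_eq (can_inj sK)) kh (sA _ kA) andbT.
  by rewrite -(inj_eq (can_inj sK)) sK.
- by case/and3P=> _ _; apply: nA.
- by case/and3P=> _ _; apply: FA.
Qed.

Section Crossing.

Variable n : nat.
Implicit Types (x y z w : vertex n).

(** Vertices of different rows do not interact. This is what makes the contributions of outer and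
    middle vertices separate in a product. *)
Definition beyond x y := (is_upper x == is_upper y) && (column y <= column x).

(* The parity of the number of crossings of a curve from [x] to [y] with a curve
   from [z] to [w] when both are drawn inside the rectangle. *)
Definition crossing x y z w :=
  (beyond x z (+) beyond y z) (+) (beyond x w (+) beyond y w).

Definition noncrossing (a : diagram n) := [forall x, forall z,
  [&& z != x, z != partner a x, partner a x != x & partner a z != z] ==>
  ~~ crossing x (partner a x) z (partner a z)].

Lemma noncrossingP a : reflect
  (forall x y z w, partner a x = y -> partner a z = w ->
     z != x -> z != y -> y != x -> w != z -> crossing x y z w = false)
  (noncrossing a).
Proof.
apply: (iffP forallP) => [nc x y z w <- <- zx zy yx wz|nc x].
  have /forallP/(_ z)/implyP := nc x.
  by move=> H; apply/negbTE/H; rewrite zx zy yx wz.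
apply/forallP=> z; apply/implyP=> /and4P[zx zy yx wz].
by rewrite (nc _ _ _ _ erefl erefl).
Qed.

Section Product.

Variables (a b : diagram n).
Hypotheses (aP : a \in partial_brauer n) (bP : b \in partial_brauer n).

Let orbit x := [set h | fconnect (advance a b) (outer x) h].

Let orbit_turn x h : h \in orbit x -> turn h \in orbit x.
Proof. by rewrite !inE; apply: fconnect_turn. Qed.

Let orbit_cross x h : h \in orbit x -> cross a b h \in orbit x.
Proof. by rewrite !inE; apply: fconnect_cross. Qed.

Let sum_outer x y (F : incidence n -> bool) : joined a b x y -> x != y ->
  (forall h, turn h != h -> F (turn h) = F h) ->
  \big[addb/false]_(h in orbit x) F h = F (outer x) (+) F (outer y).
Proof.
move=> xy ne Fturn.
have xx : outer x \in orbit x by rewrite inE connect0.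
have yx : outer y \in orbit x :\ outer x.
  rewrite !inE xpair_eqE (negPf (_ : y != x)) 1?eq_sym //=.
  exact/joinedP.
rewrite (big_setD1 _ xx) (big_setD1 _ yx) /= addbA.
rewrite (addb_involution (@turnK n)) ?addbF // => h; rewrite !in_setD1 => /and3P[hy hx ho].
- rewrite orbit_turn // andbT -{1}(turn_outer y) -{1}(turn_outer x).
  by rewrite !(inj_eq (can_inj (@turnK n))) hx hy.
- apply/negP=> /turn_fixedP[z ez]; move: hy hx ho; rewrite ez inE => zy zx.
  move/(joinedP aP bP) => xz; have := joined_uniq aP bP xy xz ne.
  case: (eqVneq x z) zx => [->|_ _ /(_ isT) yz]; first by rewrite eqxx.
  by rewrite yz eqxx in zy.
- case: (eqVneq (turn h) h) => [->//|]; exact: Fturn.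
Qed.

Let sum_cross x y (F : incidence n -> bool) : joined a b x y -> x != y ->
  {in orbit x, forall h, F (cross a b h) = F h} ->
  \big[addb/false]_(h in orbit x) F h = false.
Proof.
move=> xy ne Fcross; apply: addb_involution (crossK aP bP) _ _ Fcross => h.
  exact: orbit_cross.
rewrite inE => xh; apply: contra ne => /eqP dead.
exact/eqP/(joined_dead aP bP xh dead).
Qed.

(** The sum of [W] over all pairs of incidences of the two paths is evaluated twice. Grouped by
    [cross], it is a sum of crossing parities within one factor, hence zero. Grouped by [turn], the
    two copies of each middle vertex cancel, and the crossing parity of the outer ends remains. *)
Lemma noncrossing_dmul :
  noncrossing a -> noncrossing b -> noncrossing (dmul a b).
Proof.
move=> /noncrossingP nca /noncrossingP ncb; apply/noncrossingP=> x y z w.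
rewrite !partner_dmul // => exy ezw zx zy yx wz.
have xy : joined a b x y by rewrite -exy product_partnerP.
have zw : joined a b z w by rewrite -ezw product_partnerP.
have nxy : x != y by rewrite eq_sym.
have nzw : z != w by rewrite eq_sym.
have disj h k : h \in orbit x -> k \in orbit z -> k != h.
  rewrite !inE => xh zk; apply/eqP=> ekh; rewrite ekh in zk.
  have xz : joined a b x z.
    apply/joinedP => //; apply: connect_trans xh _.
    by rewrite (fconnect_sym (advance_inj aP bP)).
  by move: zy; rewrite (joined_uniq aP bP xy xz) 1?eq_sym ?eqxx // eq_sym.
pose W (h k : incidence n) := (h.2 == k.2) && beyond h.1 k.1.
pose G h := \big[addb/false]_(k in orbit z) W h k.
(* Within one factor, outer and middle vertices lie in different rows. *)
have W_outer h u : turn h != h -> W h (outer u) = false /\ W (outer u) h = false.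
  rewrite /W; case: h => [[] i []] /=; rewrite ?eqxx // => _;
    by case: u => j; rewrite /beyond /= ?andbF.
have W_turn h k : turn h != h -> W (turn h) (turn k) = W h k.
  rewrite /W; case: h => [[] i []] /=; rewrite ?eqxx // => _;
    by case: k => [[] j []]; rewrite /beyond /= ?andbF.
have sum0 : \big[addb/false]_(h in orbit x) G h = false.
  apply: (sum_cross xy nxy).
  move=> h xh; apply: (@addbI (G h)); rewrite addbb /G -big_split /=.
  apply: (sum_cross zw nzw).
  move=> k zk; have kh := disj _ _ xh zk.
  have kch := disj _ _ (orbit_cross xh) zk.
  have ch : cross a b h != h.
    apply: contraNneq yx => e; rewrite eq_sym; apply/eqP.
    by apply: (joined_dead aP bP _ e xy); rewrite inE in xh.
  have ck : cross a b k != k.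
    apply: contraNneq wz => e; rewrite eq_sym; apply/eqP.
    by apply: (joined_dead aP bP _ e zw); rewrite inE in zk.
  case: h k kh kch ch ck {xh zk} => [u s] [v t]; rewrite /W /cross /=.
  rewrite !xpair_eqE; case: (eqVneq s t) => [<-|_] //.
  rewrite !eqxx !andbT => vu vpu pu pv.
  suff : crossing u (partner (if s then a else b) u)
                  v (partner (if s then a else b) v) = false.
    by rewrite /crossing; do 4 case: beyond.
  by case: (s) vu vpu pu pv => *; [apply: nca|apply: ncb].
have sumE : \big[addb/false]_(h in orbit x) G h = G (outer x) (+) G (outer y).
  apply: (sum_outer xy nxy) => h nh.
  rewrite /G (reindex_inj (can_inj (@turnK n))) /=; apply: eq_big => k.
    by apply/idP/idP=> /orbit_turn; rewrite ?turnK.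
  by rewrite W_turn.
have GE u : G (outer u) = beyond u z (+) beyond u w.
  rewrite /G (sum_outer zw nzw) => [|k nk].
    by case: (u); case: (z); case: (w).
  by rewrite !(W_outer _ _ _).2 // turnK eq_sym.
move: sum0; rewrite sumE !GE /crossing.
by do 4 case: beyond.
Qed.
End Product.
End Crossing.

(** * Disjoint curves *)

Section Grid.

Variables (N : nat) (low pos : nat -> nat -> bool).

(** For the coordinates [u], [v] of [f s - g t], [low] will be [v <= 0] and [pos] will be [0 <= u].
    The edges counted are those along which the difference passes the half axis [u = 0], [v <= 0];
    along a closed path their parity is the winding number modulo 2. *)
Definition hor_change i j := [&& low i j, low i.+1 j & pos i j (+) pos i.+1 j].
Definition ver_change i j := [&& low i j, low i j.+1 & pos i j (+) pos i j.+1].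

Lemma sum_telescope (l p : nat -> bool) m : (forall j, j <= m -> l j) ->
  \big[addb/false]_(0 <= j < m) [&& l j, l j.+1 & p j (+) p j.+1] = p 0 (+) p m.
Proof.
elim: m => [|m IH] lj; first by rewrite big_nil addbb.
rewrite big_nat_recr //= IH => [|j jm]; last exact/lj/leqW.
rewrite !lj // !andTb addbA; congr addb.
by rewrite -addbA addbb addbF.
Qed.

(** Summed over all cells, every inner edge occurs twice and cancels. *)
Lemma grid_boundary :
  (forall i j, i < N -> j < N ->
     hor_change i j (+) ver_change i.+1 j (+) hor_change i j.+1 (+) ver_change i j = false) ->
  \big[addb/false]_(0 <= j < N) ver_change 0 j (+) \big[addb/false]_(0 <= j < N) ver_change N j =
  \big[addb/false]_(0 <= i < N) hor_change i 0 (+) \big[addb/false]_(0 <= i < N) hor_change i N.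
Proof.
move=> cell.
have strip i m : i < N -> m <= N ->
    \big[addb/false]_(0 <= j < m) ver_change i j (+) \big[addb/false]_(0 <= j < m) ver_change i.+1 j =
    hor_change i 0 (+) hor_change i m.
  move=> iN; elim: m => [|m IH] mN; first by rewrite !big_nil !addbb.
  rewrite !big_nat_recr //= addbACA (IH (ltnW mN)); move: (cell i m iN mN).
  by case: (hor_change i 0); case: (hor_change i m); case: (ver_change i m); case: (ver_change i.+1 m);
     case: (hor_change i m.+1).
suff : forall m, m <= N ->
    \big[addb/false]_(0 <= j < N) ver_change 0 j (+) \big[addb/false]_(0 <= j < N) ver_change m j =
    \big[addb/false]_(0 <= i < m) hor_change i 0 (+) \big[addb/false]_(0 <= i < m) hor_change i N.
  by apply.
elim=> [|m IH] mN; first by rewrite !big_nil !addbb.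
rewrite !(big_nat_recr m) //= addbACA -(strip m N mN (leqnn N)) -(IH (ltnW mN)).
by rewrite -addbA (addbA _ _ (\big[_/_]_(_ <= j < _) ver_change m.+1 j)) addbb addFb.
Qed.

End Grid.

Section Curves.

Import all_order all_algebra classical_sets interval_inference prodnormedzmodule.
Import topology normedtype sequences lra ring finset.
Import numFieldNormedType.Exports Order.TTheory GRing.Theory Num.Theory.

Local Open Scope ring_scope.
Local Open Scope classical_set_scope.

Variable R : realType.
Implicit Types (f g : R -> R * R) (s t : R).

Lemma within_continuous_dist f s e : {within `[0, 1], continuous f} ->
  0 <= s <= 1 -> 0 < e ->
  exists2 d, 0 < d & forall t, 0 <= t <= 1 -> `|s - t| < d ->
    `|(f s).1 - (f t).1| < e /\ `|(f s).2 - (f t).2| < e.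
Proof.
move=> /subspace_continuousP cf s01 e0.
have := cf s; rewrite /= in_itv /= s01 => /(_ isT)/cvgrPdist_lt/(_ e e0).
move/nbhs_ballP=> [d /= d0 near_s]; exists d => // t t01 st.
have /= := near_s t st; rewrite in_itv /= t01 => /(_ isT).
by rewrite ProdNormedZmodule.prod_normE /= gt_max => /andP.
Qed.

Definition constant_sign (u v : R -> R -> R) (D : R -> R -> Prop) :=
  [\/ forall s t, D s t -> 0 < u s t, forall s t, D s t -> u s t < 0,
      forall s t, D s t -> 0 < v s t | forall s t, D s t -> v s t < 0].

(** Near each point of the square some coordinate of [f s - g t] is nonzero and keeps its sign by
    continuity; compactness of the square makes the mesh uniform. *)
Lemma fine_grid f g :
  {within `[0, 1], continuous f} -> {within `[0, 1], continuous g} ->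
  (forall s t, 0 <= s <= 1 -> 0 <= t <= 1 -> f s <> g t) ->
  exists N : nat, forall s t, 0 <= s <= 1 -> 0 <= t <= 1 ->
    constant_sign (fun s t => (f s).1 - (g t).1) (fun s t => (f s).2 - (g t).2)
      (fun s' t' => [/\ 0 <= s' <= 1, 0 <= t' <= 1,
         `|s - s'| <= N.+1%:R^-1 & `|t - t'| <= N.+1%:R^-1]).
Proof.
move=> cf cg ne.
pose P (N : nat) (p : R * R) :=
  constant_sign (fun s t => (f s).1 - (g t).1) (fun s t => (f s).2 - (g t).2)
      (fun s' t' => [/\ 0 <= s' <= 1, 0 <= t' <= 1,
         `|p.1 - s'| <= N.+1%:R^-1 & `|p.2 - t'| <= N.+1%:R^-1]).
have cK : compact (`[0, 1]%classic `*` `[0, 1]%classic : set (R * R)).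
  by apply: compact_setX; apply: segment_compact.
suff loc : forall p : R * R, (`[0, 1]%classic `*` `[0, 1]%classic) p ->
    \forall p' \near p & N \near \oo, P N p'.
  have [N _ HN] := (compact_near_coveringP _).1 cK nat \oo P _ loc.
  exists N => s t s01 t01; apply: (HN N (leqnn N) (s, t)) => /=.
  by split; rewrite /= in_itv.
move=> [s t] [/=]; rewrite !in_itv /= => s01 t01.
  have local e : 0 < e -> exists2 d, 0 < d & forall s' t', 0 <= s' <= 1 -> 0 <= t' <= 1 ->
      `|s - s'| < d -> `|t - t'| < d ->
      [/\ `|(f s).1 - (f s').1| < e, `|(f s).2 - (f s').2| < e,
          `|(g t).1 - (g t').1| < e & `|(g t).2 - (g t').2| < e].
    move=> e0; have [d d0 fd] := within_continuous_dist cf s01 e0.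
    have [d' d'0 gd] := within_continuous_dist cg t01 e0.
    exists (Num.min d d') => [|s' t' s'01 t'01]; first by rewrite lt_min d0.
    rewrite !lt_min => /andP[sd _] /andP[_ td].
    by have [] := fd s' s'01 sd; have [] := gd t' t'01 td.
  (* One half of [d] is for the distance from [(s, t)] to the centre of the small square, the other
     for its mesh. *)
  have spread d : 0 < d -> \forall s' \near (s, t) & N \near \oo,
      `|s - s'.1| < d / 2 /\ `|t - s'.2| < d / 2 /\ N.+1%:R^-1 < d / 2.
    move=> d0; exists (ball (s, t) (d / 2), [set N : nat | N.+1%:R^-1 < d / 2]).
      have d20 : 0 < d / 2 by rewrite divr_gt0.
      split; first exact: nbhsx_ballx.
      exact: near_infty_natSinv_lt (PosNum d20).
    by move=> [[s' t'] N] /= [[]].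
  have near_sign (D : (R -> R -> Prop) -> Prop) e :
      (forall D1 D2 : R -> R -> Prop, (forall x y, D1 x y -> D2 x y) -> D D2 -> D D1) ->
      0 < e -> D (fun s' t' => [/\ `|(f s).1 - (f s').1| < e, `|(f s).2 - (f s').2| < e,
          `|(g t).1 - (g t').1| < e & `|(g t).2 - (g t').2| < e]) ->
      \forall p \near (s, t) & N \near \oo, D (fun s' t' => [/\ 0 <= s' <= 1, 0 <= t' <= 1,
         `|p.1 - s'| <= N.+1%:R^-1 & `|p.2 - t'| <= N.+1%:R^-1]).
    move=> mono e0 De; have [d d0 close] := local e e0.
    apply: filterS (spread d d0) => -[[s' t'] N] /= [ss' [tt' Nd]].
    apply: mono De => x y [x01 y01 sx ty]; apply: close => //.
      by move: ss' (le_lt_trans sx Nd); rewrite !ltr_norml; lra.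
    by move: tt' (le_lt_trans ty Nd); rewrite !ltr_norml; lra.
  pose u := (f s).1 - (g t).1; pose v := (f s).2 - (g t).2.
  have mono u' v' (D1 D2 : R -> R -> Prop) : (forall x y, D1 x y -> D2 x y) ->
      constant_sign u' v' D2 -> constant_sign u' v' D1.
    move=> sub [] H; [apply: Or41|apply: Or42|apply: Or43|apply: Or44];
      by move=> x y /sub/H.
  have : u != 0 \/ v != 0.
    apply/orP; rewrite -negb_and; apply/negP=> /andP[]; rewrite !subr_eq0 => /eqP e1 /eqP e2.
    apply: (ne s t s01 t01).
    by rewrite [f s]surjective_pairing [g t]surjective_pairing e1 e2.
(* Each of the two curves moves by less than half of the nonzero coordinate [w], so their difference
   cannot change sign. *)
have e0 (w : R) : w != 0 -> 0 < `|w| / 2 by move=> w0; rewrite divr_gt0 ?normr_gt0.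
have conclude (w : R) : w != 0 ->
    constant_sign (fun s t => (f s).1 - (g t).1) (fun s t => (f s).2 - (g t).2)
      (fun s' t' => [/\ `|(f s).1 - (f s').1| < `|w| / 2, `|(f s).2 - (f s').2| < `|w| / 2,
          `|(g t).1 - (g t').1| < `|w| / 2 & `|(g t).2 - (g t').2| < `|w| / 2]) ->
    \forall p \near (s, t) & N \near \oo, P N p.
  by move=> w0; apply: (near_sign (constant_sign _ _) _ (mono _ _) (e0 w w0)).
case=> /[dup] nz; rewrite neq_lt => /orP[] sg; apply: (conclude _ nz).
- apply: Or42 => s' t'; rewrite !ltr_norml (ltr0_norm sg) /u.
  by case; move: sg; rewrite /u; lra.
- apply: Or41 => s' t'; rewrite !ltr_norml (gtr0_norm sg) /u.
  by case; move: sg; rewrite /u; lra.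
- apply: Or44 => s' t'; rewrite !ltr_norml (ltr0_norm sg) /v.
  by case; move: sg; rewrite /v; lra.
- apply: Or43 => s' t'; rewrite !ltr_norml (gtr0_norm sg) /v.
  by case; move: sg; rewrite /v; lra.
Qed.

Lemma disjoint_curves n f g (x y z w : vertex n) :
  {within `[0, 1], continuous f} -> {within `[0, 1], continuous g} ->
  f 0 = position R x -> f 1 = position R y ->
  g 0 = position R z -> g 1 = position R w ->
  (forall s, 0 <= s <= 1 -> 0 <= (f s).2 <= 1) ->
  (forall t, 0 <= t <= 1 -> 0 <= (g t).2 <= 1) ->
  (forall s t, 0 <= s <= 1 -> 0 <= t <= 1 -> f s <> g t) ->
  crossing x y z w = false.
Proof.
move=> cf cg f0 f1 g0 g1 fb gb ne; have [N grid] := fine_grid cf cg ne.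
pose q i : R := i%:R / N.+1%:R.
have q01 i : (i <= N.+1)%N -> 0 <= q i <= 1.
  by move=> iN; rewrite divr_ge0 //= ler_pdivrMr ?ltr0Sn // mul1r ler_nat.
have q0 : q 0 = 0 by rewrite /q mul0r.
have qN : q N.+1 = 1 by rewrite /q divff // pnatr_eq0.
have qS i : q i.+1 - q i = N.+1%:R^-1.
  by rewrite /q -mulrBl -natrB // subSnn mul1r.
have qd i j : (i <= j <= i.+1)%N -> `|q i - q j| <= N.+1%:R^-1.
  case/andP=> ij; rewrite leq_eqVlt ltnS => /orP[/eqP->|ji].
    by rewrite distrC qS gtr0_norm ?invr_gt0 ?ltr0Sn.
  by rewrite (eqP (_ : i == j)) ?eqn_leq ?ij // subrr normr0 invr_ge0 ler0n.
pose u i j := (f (q i)).1 - (g (q j)).1; pose v i j := (f (q i)).2 - (g (q j)).2.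
pose low i j := v i j <= 0; pose pos i j := 0 <= u i j.
pose D i j k l := (i <= k <= i.+1)%N && (j <= l <= j.+1)%N.
have sign i j : (i < N.+1)%N -> (j < N.+1)%N ->
    [\/ forall k l, D i j k l -> 0 < u k l, forall k l, D i j k l -> u k l < 0,
        forall k l, D i j k l -> 0 < v k l | forall k l, D i j k l -> v k l < 0].
  move=> iN jN.
  have H k l : D i j k l -> [/\ 0 <= q k <= 1, 0 <= q l <= 1,
         `|q i - q k| <= N.+1%:R^-1 & `|q j - q l| <= N.+1%:R^-1].
    case/andP=> ik jl; split; rewrite ?qd //; apply: q01.
      by case/andP: ik => _ /leq_trans; apply.
    by case/andP: jl => _ /leq_trans; apply.
  case: (grid _ _ (q01 _ (ltnW iN)) (q01 _ (ltnW jN))) => G;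
    [apply: Or41|apply: Or42|apply: Or43|apply: Or44] => k l /H; exact: G.
(* Nothing is counted if [u] keeps its sign or [v > 0]. If [v < 0], all corners are low and the sign
   of [u] changes an even number of times around the cell. *)
have cell i j : (i < N.+1)%N -> (j < N.+1)%N ->
    hor_change low pos i j (+) ver_change low pos i.+1 j (+) hor_change low pos i j.+1 (+) ver_change low pos i j = false.
  move=> iN jN; rewrite /hor_change /ver_change /low /pos.
  have [c1 c2 c3 c4] : [/\ D i j i j, D i j i.+1 j, D i j i j.+1 & D i j i.+1 j.+1].
    by rewrite /D !leqnn !leqnSn.
  case: (sign i j iN jN) => S; move: (S _ _ c1) (S _ _ c2) (S _ _ c3) (S _ _ c4).
  - by do 4 move/ltW=> ->; rewrite !andbF.
  - by do 4 (rewrite ltNge => /negbTE ->); rewrite !andbF.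
  - by do 4 (rewrite ltNge => /negbTE ->).
  - do 4 move/ltW=> ->; rewrite !andTb.
    by case: (0 <= u i j); case: (0 <= u i.+1 j); case: (0 <= u i j.+1);
       case: (0 <= u i.+1 j.+1).
(* A low point with [0 <= v] has [v = 0]; then [v] has no strict sign on the cell, so [u] has
   one. *)
have high i j k l k' l' : (i < N.+1)%N -> (j < N.+1)%N -> D i j k l -> D i j k' l' ->
    0 <= v k l -> 0 <= v k' l' -> [&& low k l, low k' l' & pos k l (+) pos k' l'] = false.
  move=> iN jN d d' v0 v0'; rewrite /low /pos.
  case: (sign i j iN jN) => S; move: (S _ _ d) (S _ _ d').
  - by do 2 move/ltW=> ->; rewrite !andbF.
  - by do 2 (rewrite ltNge => /negbTE ->); rewrite !andbF.
  - by do 2 (rewrite ltNge => /negbTE ->).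
  - by rewrite ltNge v0.
have colE (a b : vertex n) : (0 <= (position R a).1 - (position R b).1) = (column b <= column a)%N.
  by rewrite subr_ge0; case: a => a; case: b => b; rewrite ler_nat.
(* Here [f] rests at [a] on the border of the strip, which fixes the sign of [v]. For a lower [a]
   all points are low and the sum telescopes; for an upper [a] nothing is counted. For [g] in
   [horiz] the rows are exchanged. *)
have vert i c (a : vertex n) : q i = c -> f c = position R a -> i = 0 \/ i = N.+1 ->
    \big[addb/false]_(0 <= j < N.+1) ver_change low pos i j =
    ~~ is_upper a && ((column z <= column a)%N (+) (column w <= column a)%N).
  move=> qi fa i_end.
  have v_a l : v i l = (position R a).2 - (g (q l)).2 by rewrite /v qi fa.
  have [i' i'N Di] : exists2 i', (i' < N.+1)%N & (i' <= i <= i'.+1)%N.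
    by case: i_end => ->; [exists 0|exists N]; rewrite ?leqnn ?leqnSn.
  case: a fa v_a => a fa v_a; last first.
    rewrite (sum_telescope (pos i) (l := low i)) => [|l lN].
      by rewrite /pos /u q0 qN qi fa g0 g1 !colE.
    by rewrite /low v_a /= sub0r oppr_le0; case/andP: (gb _ (q01 l lN)).
  rewrite big_nat big1 // => l /andP[_ lN].
  have v0 k : (k <= N.+1)%N -> 0 <= v i k.
    by move=> kN; rewrite v_a /= subr_ge0; case/andP: (gb _ (q01 k kN)).
  by apply: (high i' l); rewrite ?v0 // /D ?Di ?leqnn ?leqnSn // ltnW.
have horiz j c (a : vertex n) : q j = c -> g c = position R a -> j = 0 \/ j = N.+1 ->
    \big[addb/false]_(0 <= i < N.+1) hor_change low pos i j =
    is_upper a && ((column a <= column x)%N (+) (column a <= column y)%N).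
  move=> qj ga j_end.
  have v_a l : v l j = (f (q l)).2 - (position R a).2 by rewrite /v qj ga.
  have [j' j'N Dj] : exists2 j', (j' < N.+1)%N & (j' <= j <= j'.+1)%N.
    by case: j_end => ->; [exists 0|exists N]; rewrite ?leqnn ?leqnSn.
  case: a ga v_a => a ga v_a.
    rewrite (sum_telescope (pos^~ j) (l := low^~ j)) => [|l lN].
      by rewrite /pos /u q0 qN qj ga f0 f1 !colE.
    by rewrite /low v_a /= subr_le0; case/andP: (fb _ (q01 l lN)).
  rewrite big_nat big1 // => l /andP[_ lN].
  have v0 k : (k <= N.+1)%N -> 0 <= v k j.
    by move=> kN; rewrite v_a /= subr0; case/andP: (fb _ (q01 k kN)).
  by apply: (high l j'); rewrite ?v0 // /D ?Dj ?leqnn ?leqnSn // ltnW.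
have := grid_boundary cell.
rewrite (vert _ _ _ q0 f0) ?(vert _ _ _ qN f1) ?(horiz _ _ _ q0 g0) ?(horiz _ _ _ qN g1); auto.
(* An end [x] of [f] and an end [z] of [g] contribute the comparison of their columns once if they
   share a row, twice if [x] is lower and [z] upper, and never in the opposite case. Modulo 2 this
   is [crossing]. *)
rewrite /crossing /beyond.
case: (is_upper x); case: (is_upper y); case: (is_upper z); case: (is_upper w) => /=;
by case: (column z <= column x)%N; case: (column z <= column y)%N;
   case: (column w <= column x)%N; case: (column w <= column y)%N.
Qed.

Lemma crossingC n (x y z w : vertex n) : crossing y x z w = crossing x y z w.
Proof. by rewrite /crossing (addbC (beyond y z)) (addbC (beyond y w)). Qed.

Lemma crossingC' n (x y z w : vertex n) : crossing x y w z = crossing x y z w.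
Proof. by rewrite /crossing addbC. Qed.

Lemma planar_noncrossing n (a : diagram n) :
  a \in partial_brauer n -> planar R a -> noncrossing a.
Proof.
move=> aP [arc [arcs disj]]; apply/noncrossingP=> x y z w xy zw zx zy yx wz.
have Ba : [set x; y]%SET \in edges a by rewrite mem_edges // eq_sym yx xy /=.
have Ca : [set z; w]%SET \in edges a by rewrite mem_edges // eq_sym wz zw /=.
have BC : [set x; y]%SET != [set z; w]%SET.
  apply/eqP=> /setP/(_ z); rewrite !inE eqxx /= (negPf zx) (negPf zy).
  by [].
have [cf _ [x' [y' [eB f0 f1]]] fb _] := arcs _ Ba.
have [cg _ [z' [w' [eC g0 g1]]] gb _] := arcs _ Ca.
(* An arc may run through its edge in either direction. *)
have ends (p q p' q' : vertex n) : q != p -> [set p; q]%SET = [set p'; q']%SET ->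
    p' = p /\ q' = q \/ p' = q /\ q' = p.
  move=> qp e; have : p' \in [set p; q]%SET by rewrite e set21.
  rewrite !inE => /orP[] /eqP ep; [left|right]; split=> //; apply/esym.
    by move: e; rewrite ep => /eq_set2.
  by move: e; rewrite ep [[set p; q]%SET]finset.setUC => /eq_set2.
have := disjoint_curves cf cg f0 f1 g0 g1.
have [] := ends _ _ _ _ yx eB; have [] := ends _ _ _ _ wz eC;
  case=> -> -> [-> ->]; rewrite ?(crossingC x) ?(crossingC' _ _ z); apply;
  do ?[by move=> s s01; have [|_] := fb s; rewrite ?in_itv
      |by move=> s s01; have [|_] := gb s; rewrite ?in_itv];
  move=> s t s01 t01; apply: disj Ba Ca BC _ _ _ _; by rewrite in_itv.
Qed.

End Curves.

(** * Drawing noncrossing diagrams *)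

Section Drawing.

Import all_order all_algebra classical_sets interval_inference prodnormedzmodule.
Import topology normedtype sequences lra ring finset.
Import numFieldNormedType.Exports Order.TTheory GRing.Theory Num.Theory.

Local Open Scope ring_scope.
Local Open Scope classical_set_scope.

Variables (R : realType) (n : nat).
Implicit Types (x y z w : vertex n) (i j k l : 'I_n).

Let eps : R := n%:R^-1.
Let abscissa x : R := (column x : nat)%:R.

(** Implicit equations of the arcs: a common point of two arcs then satisfies both systems, without
    any curve parameter. The condition [0 <= d] keeps the abscissa between the two columns. *)
Definition curve x y (P : R * R) : Prop :=
  let i := abscissa x in let j := abscissa y in
  let d := (P.1 - i) * (j - P.1) in
  match x, y with
  | inl _, inl _ => 0 <= d /\ P.2 = 1 - eps ^+ 3 * d
  | inr _, inr _ => 0 <= d /\ P.2 = eps ^+ 3 * d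
  | inl _, inr _ => 0 <= P.2 <= 1 /\ P.1 = P.2 * i + (1 - P.2) * j
  | inr _, inl _ => 0 <= P.2 <= 1 /\ P.1 = P.2 * j + (1 - P.2) * i
  end.

(** The factor [1 - a - b] is [-1] for upper hooks, [1] for lower hooks and [0] for transversals. *)
Definition arc x y (t : R) : R * R :=
  let: (i, a) := position R x in let: (j, b) := position R y in
  (i + t * (j - i),
   a + t * (b - a) + (1 - a - b) * (eps ^+ 3 * (t * (1 - t) * (j - i) ^+ 2))).

Lemma curveC x y P : curve x y P -> curve y x P.
Proof.
by case: x y => [x|x] [y|y] //=; rewrite /curve /= [(P.1 - _) * _]mulrC
  -(opprB P.1) -[X in _ * X]opprB mulrNN.
Qed.

Lemma arc_curve x y t : 0 <= t <= 1 -> curve x y (arc x y t).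
Proof.
move=> t01; have sq (d : R) : 0 <= t * (1 - t) * d ^+ 2.
  by rewrite mulr_ge0 ?sqr_ge0 // mulr_ge0; lra.
case: x y => [x|x] [y|y]; rewrite /curve /arc /=; (split; last by ring).
- by have := sq (abscissa (inl y) - abscissa (inl x)); congr (0 <= _); ring.
- by lra.
- by lra.
- by have := sq (abscissa (inr y) - abscissa (inr x)); congr (0 <= _); ring.
Qed.

Lemma between (i j X : R) : i < j -> 0 <= (X - i) * (j - X) -> i <= X <= j.
Proof. by move=> ij d; apply/andP; split; rewrite leNgt; apply/negP=> lt; nra. Qed.

Lemma epsP i : [/\ 0 < eps, eps * n%:R = 1 & (i : nat)%:R + 1 <= n%:R :> R].
Proof.
have n0 : (0 < n)%N by apply: leq_ltn_trans (ltn_ord i).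
split; rewrite ?invr_gt0 ?ltr0n // ?mulVf ?pnatr_eq0 -?lt0n //.
by rewrite natr1 ler_nat.
Qed.

(** The product is at most [n ^ 2 / 4], so the exponent 3 leaves one factor [eps], which later
    absorbs the at most [n] columns that a transversal moves. *)
Lemma hook_depth i j (X : R) : 0 <= (X - i%:R) * (j%:R - X) ->
  0 <= eps ^+ 3 * ((X - i%:R) * (j%:R - X)) <= eps / 4.
Proof.
move=> d0; have [e0 en iN] := epsP i; have [_ _ jN] := epsP j.
have i0 : 0 <= (i : nat)%:R :> R by []; have j0 : 0 <= (j : nat)%:R :> R by [].
rewrite mulr_ge0 ?exprn_ge0 ?(ltW e0) //=.
have d4 : (X - i%:R) * (j%:R - X) <= n%:R ^+ 2 / 4.
  have : 0 <= ((X - i%:R) - (j%:R - X)) ^+ 2 by apply: sqr_ge0.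
  have : ((j : nat)%:R - (i : nat)%:R) ^+ 2 <= n%:R ^+ 2 :> R by nra.
  by nra.
apply: le_trans (ler_wpM2l (exprn_ge0 3 (ltW e0)) d4) _.
suff -> : eps ^+ 3 * (n%:R ^+ 2 / 4) = eps * (eps * n%:R) ^+ 2 / 4 by rewrite en expr1n mulr1.
by field.
Qed.

(** Even parity makes the two intervals disjoint, so that they share no abscissa, or strictly
    nested. In the second case the parabola of the outer one is strictly deeper over the inner
    one. *)
Lemma hooks_disjoint (i j k l : nat) (X : R) :
  i != j -> k != l -> [&& k != i, k != j, l != i & l != j] ->
  (((k <= i) (+) (k <= j)) (+) ((l <= i) (+) (l <= j)))%N = false ->
  0 <= (X - i%:R) * (j%:R - X) -> (X - i%:R) * (j%:R - X) = (X - k%:R) * (l%:R - X) ->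
  False.
Proof.
wlog ij : i j / (i < j)%N => [IH|].
  case: (ltngtP i j) => // [ij|ji] _; first by apply: IH; rewrite ?ltn_eqF.
  move=> kl /and4P[ki kj li lj] par d e; apply: (IH j i ji _ kl).
  - by rewrite ltn_eqF.
  - by rewrite kj ki lj li.
  - by rewrite -par ![(_ <= j)%N (+) _]addbC.
  - by move: d; congr (0 <= _); ring.
  - by rewrite -e; ring.
move=> _; wlog kl : k l / (k < l)%N => [IH|].
  case: (ltngtP k l) => // [kl|lk] _; first by apply: IH; rewrite ?ltn_eqF.
  move=> /and4P[ki kj li lj] par d e; apply: (IH l k lk _ _ _ d).
  - by rewrite ltn_eqF.
  - by rewrite li lj ki kj.
  - by rewrite addbC.
  - by rewrite e; ring.
move=> _ /and4P[ki kj li lj] par d e.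
have ijR : i%:R < j%:R :> R by rewrite ltr_nat.
have klR : k%:R < l%:R :> R by rewrite ltr_nat.
have := between ijR d; have := @between _ _ X klR; rewrite -e => /(_ d) /andP[kX Xl] /andP[iX Xj].
have : (i%:R < k%:R :> R /\ l%:R < j%:R :> R) \/ (k%:R < i%:R :> R /\ j%:R < l%:R :> R).
  have : k%:R <= j%:R :> R by apply: le_trans Xj.
  have : i%:R <= l%:R :> R by apply: le_trans Xl.
  rewrite !ler_nat !ltr_nat; move: par ki kj li lj ij kl.
  by case: (ltngtP k i); case: (ltngtP k j); case: (ltngtP l i); case: (ltngtP l j) => //= *; lia.
by case=> -[? ?]; nra.
Qed.

(* A hook stays so close to its row that, at that height, a transversal is within
   distance 1/4 of the column of its endpoint in this row. *)
Lemma hook_line_disjoint i j k (X h m : R) :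
  i != j -> k != i -> k != j -> ((k <= i) (+) (k <= j))%N = false ->
  0 <= (X - i%:R) * (j%:R - X) -> h = eps ^+ 3 * ((X - i%:R) * (j%:R - X)) ->
  0 <= m <= n%:R -> X = (1 - h) * k%:R + h * m -> False.
Proof.
wlog ij : i j / (i < j)%N => [IH|].
  rewrite -val_eqE /=; case: (ltngtP i j) => // [ij|ji] _.
    by apply: IH => //; rewrite -val_eqE /= ltn_eqF.
  move=> ki kj par d e; apply: (IH j i ji _ kj ki).
  - by rewrite -val_eqE /= ltn_eqF.
  - by rewrite addbC.
  - by move: d; congr (0 <= _); ring.
  - by rewrite e; congr (_ * _); ring.
move=> _ ki kj par d e m01 Xe.
have ijR : (i : nat)%:R < (j : nat)%:R :> R by rewrite ltr_nat.
have /andP[iX Xj] := between ijR d.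
have [e0 en kN] := epsP k; have k0 : 0 <= (k : nat)%:R :> R by [].
have := hook_depth d; rewrite -e => /andP[h0 h4].
have : `|X - k%:R| <= 1 / 4.
  have mk : `|m - k%:R| <= n%:R by rewrite ler_norml; lra.
  have -> : X - k%:R = h * (m - k%:R) by rewrite Xe; ring.
  rewrite normrM ger0_norm //; apply: le_trans (ler_pM h0 (normr_ge0 _) h4 mk) _.
  by rewrite mulrAC en.
have : (k < i)%N \/ (j < k)%N.
  move: ki kj par; rewrite -!val_eqE /=.
  by case: (ltngtP k i); case: (ltngtP k j) => //; auto.
rewrite ler_norml => -[]; rewrite -(@ler_nat R) -natr1; lra.
Qed.

(** Exchanging the arguments of [beyond] adds the bit of a common row, and these bits sum to zero
    over the four pairs of ends. *)
Lemma crossing_swap x y z w : [&& z != x, z != y, w != x & w != y] ->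
  crossing z w x y = crossing x y z w.
Proof.
have beyondC (u v : vertex n) : u != v ->
    beyond v u = beyond u v (+) (is_upper u == is_upper v).
  case: u v => [i|i] [j|j] ne; rewrite /beyond //= addbT.
    by case: (ltngtP i j) => // /val_inj ij; rewrite ij eqxx in ne.
  by case: (ltngtP i j) => // /val_inj ij; rewrite ij eqxx in ne.
case/and4P=> zx zy wx wy; rewrite /crossing.
rewrite [in LHS](beyondC x z) 1?eq_sym // [in LHS](beyondC x w) 1?eq_sym //.
rewrite [in LHS](beyondC y z) 1?eq_sym // [in LHS](beyondC y w) 1?eq_sym //.
move: (beyond x z) (beyond x w) (beyond y z) (beyond y w) => b1 b2 b3 b4.
by case: (is_upper x); case: (is_upper y); case: (is_upper z); case: (is_upper w);
   case: b1; case: b2; case: b3; case: b4.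
Qed.

Lemma curve_disjoint x y z w P :
  crossing x y z w = false -> x != y -> z != w ->
  [&& z != x, z != y, w != x & w != y] -> curve x y P -> curve z w P -> False.
Proof.
have ord01 i : 0 <= ((i : nat)%:R : R) <= n%:R.
  by rewrite ler0n ler_nat ltnW.
have UL i j k l : curve (inl i) (inl j) P -> curve (inr k) (inr l) P -> False.
  rewrite /curve /= => -[d e] [d' e']; have [e0 en iN] := epsP i.
  have := hook_depth d; have := hook_depth d'; rewrite -e' => /andP[_ h'] /andP[_ h].
  have : eps <= 1 by have := ord01 i; nra.
  by move: e h; rewrite /abscissa /=; lra.
have UT i j k l : crossing (inl i) (inl j) (inl k) (inr l) = false ->
    i != j -> k != i -> k != j ->
    curve (inl i) (inl j) P -> curve (inl k) (inr l) P -> False.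
  rewrite /curve /crossing /beyond /= addbF => par ij ki kj [d e] [P01 eX].
  apply: (hook_line_disjoint ij ki kj par d _ (ord01 l)) (_ : P.1 = (1 - (1 - P.2)) * _ + (1 - P.2) * _).
    by rewrite e; ring.
  by rewrite eX; ring.
have LT i j k l : crossing (inr i) (inr j) (inl k) (inr l) = false ->
    i != j -> l != i -> l != j ->
    curve (inr i) (inr j) P -> curve (inl k) (inr l) P -> False.
  rewrite /curve /crossing /beyond /= => par ij ki kj [d e] [P01 eX].
  apply: (hook_line_disjoint ij ki kj par d e (ord01 k)).
  by rewrite eX; ring.
have TT i j k l : crossing (inl i) (inr j) (inl k) (inr l) = false ->
    i != k -> j != l ->
    curve (inl i) (inr j) P -> curve (inl k) (inr l) P -> False.
  rewrite /curve /crossing /beyond /= addbF -!val_eqE /= => par ik jl [P01 eX] [_ eX'].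
  have : (i < k)%N /\ (j < l)%N \/ (k < i)%N /\ (l < j)%N.
    by move: par ik jl; case: (ltngtP k i); case: (ltngtP l j) => //=; auto.
  rewrite -!(@ler_nat R) -!natr1 => H; move: eX eX'; rewrite /abscissa /= => ->.
  by case/andP: P01 => Y0 Y1 e; case: H => -[H1 H2]; nra.
(* The symmetries of [Q] reduce the sixteen distributions of the ends over the rows to six. *)
pose Q x y z w := crossing x y z w = false -> x != y -> z != w ->
  [&& z != x, z != y, w != x & w != y] -> curve x y P -> curve z w P -> False.
have Qxy x' y' z' w' : Q x' y' z' w' -> Q y' x' z' w'.
  move=> q; rewrite /Q crossingC eq_sym => c xy zw /and4P[? ? ? ?] /curveC.
  by apply: q => //; apply/and4P.
have Qzw x' y' z' w' : Q x' y' z' w' -> Q x' y' w' z'.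
  move=> q; rewrite /Q crossingC' (eq_sym w') => c xy zw /and4P[? ? ? ?] cx /curveC.
  by apply: q => //; apply/and4P.
have Qpair x' y' z' w' : Q x' y' z' w' -> Q z' w' x' y'.
  move=> q; rewrite /Q => c xy zw /and4P[? ? ? ?] cz cx.
  have d : [&& z' != x', z' != y', w' != x' & w' != y'].
    by apply/and4P; split; rewrite eq_sym.
  by apply: q => //; rewrite -crossing_swap.
have QUT i j k l : Q (inl i) (inl j) (inl k) (inr l).
  by move=> c ij _ /and4P[ki kj _ _]; apply: UT.
have QLT i j k l : Q (inr i) (inr j) (inl k) (inr l).
  by move=> c ij _ /and4P[_ _ li lj]; apply: LT.
have QTT i j k l : Q (inl i) (inr j) (inl k) (inr l).
  by move=> c _ _ /and4P[ki _ _ lj]; apply: TT => //; rewrite eq_sym.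
have QUL i j k l : Q (inl i) (inl j) (inr k) (inr l) by move=> _ _ _ _; apply: UL.
have e3 i : eps ^+ 3 != 0 by have [e0 _ _] := epsP i; rewrite expf_neq0 ?gt_eqF.
have QUU i j k l : Q (inl i) (inl j) (inl k) (inl l).
  rewrite /Q /crossing /beyond /curve /= => c ij kl D [d e] [_].
  rewrite e => /addrI/oppr_inj/(mulfI (e3 i)); apply: hooks_disjoint d; rewrite -?val_eqE //.
have QLL i j k l : Q (inr i) (inr j) (inr k) (inr l).
  rewrite /Q /crossing /beyond /curve /= => c ij kl D [d e] [_].
  rewrite e => /(mulfI (e3 i)); apply: hooks_disjoint d; rewrite -?val_eqE //.
suff : Q x y z w by [].
case: x y z w => [x|x] [y|y] [z|z] [w|w]; rewrite /=; auto 6.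
Qed.

Lemma arc_continuous x y : continuous (arc x y).
Proof.
move=> t; rewrite /arc; case: (position R x) => i a; case: (position R y) => j b.
pose F1 (t : R) := i + t * (j - i).
pose F2 (t : R) := a + t * (b - a) + (1 - a - b) * (eps ^+ 3 * (t * (1 - t) * (j - i) ^+ 2)).
apply: (@cvg_pair _ _ _ _ (nbhs (F1 t)) (nbhs (F2 t)) _ _ _ F1 F2); rewrite /F1 /F2.
  by apply: cvgD; [exact: cvg_cst|apply: cvgM; [exact: cvg_id|exact: cvg_cst]].
apply: cvgD; last first.
  apply: cvgM; first exact: cvg_cst.
  apply: cvgM; first exact: cvg_cst.
  apply: cvgM; last exact: cvg_cst.
  apply: cvgM; first exact: cvg_id.
  by apply: cvgB; [exact: cvg_cst|exact: cvg_id].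
by apply: cvgD; [exact: cvg_cst|apply: cvgM; [exact: cvg_id|exact: cvg_cst]].
Qed.

Lemma arc_height x y t : x != y -> 0 <= t <= 1 ->
  0 <= (arc x y t).2 <= 1 /\ (0 < t < 1 -> 0 < (arc x y t).2 < 1).
Proof.
move=> xy t01.
have e1 : eps / 4 < 1.
  have [e0 en iN] := epsP (column x).
  have i0 : 0 <= ((column x : nat)%:R : R) by []; nra.
have depth : 0 <= eps ^+ 3 * (t * (1 - t) * (abscissa y - abscissa x) ^+ 2) <= eps / 4.
  have -> : t * (1 - t) * (abscissa y - abscissa x) ^+ 2 =
      ((abscissa x + t * (abscissa y - abscissa x)) - abscissa x) *
      (abscissa y - (abscissa x + t * (abscissa y - abscissa x))) by ring.
  apply: hook_depth; set d := abscissa y - abscissa x.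
  have -> : (abscissa x + t * d - (column x : nat)%:R) *
      ((column y : nat)%:R - (abscissa x + t * d)) = t * (1 - t) * d ^+ 2.
    by rewrite /d /abscissa; ring.
  by rewrite mulr_ge0 ?sqr_ge0 // mulr_ge0; lra.
have depth0 : is_upper x = is_upper y -> 0 < t < 1 ->
    0 < eps ^+ 3 * (t * (1 - t) * (abscissa y - abscissa x) ^+ 2).
  move=> side /andP[t0 t1]; have [e0 _ _] := epsP (column x).
  have sq0 : 0 < (abscissa y - abscissa x) ^+ 2.
    rewrite exprn_even_gt0 //= subr_eq0 eqr_nat; apply: contraNneq xy => e.
    by move: side e; case: (x) (y) => [i|i] [j|j] //= _ /val_inj ->.
  by rewrite mulr_gt0 ?exprn_gt0 // mulr_gt0 // mulr_gt0 // subr_gt0.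
move: depth depth0; rewrite /arc /abscissa; case: (x) (y) => [i|i] [j|j] /=.
- by move=> D /(_ erefl) D0; split=> [|/D0]; lra.
- by move=> D _; split; lra.
- by move=> D _; split; lra.
- by move=> D /(_ erefl) D0; split=> [|/D0]; lra.
Qed.

Lemma noncrossing_planar (a : diagram n) :
  a \in partial_brauer n -> noncrossing a -> planar R a.
Proof.
move=> aP /noncrossingP nc.
(* Drawing requires an orientation of the edge; [pick] chooses one. *)
pose draw (B : {set vertex n}) : R -> R * R :=
  if [pick x | B == [set x; partner a x]%SET] is Some x then arc x (partner a x)
  else fun=> (0, 0).
have drawP B : B \in edges a ->
    exists x y, [/\ draw B = arc x y, partner a x = y, x != y & B = [set x; y]%SET].
  rewrite inE => /andP[Ba B2]; rewrite /draw; case: pickP => [x /eqP eB|none].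
    exists x, (partner a x); split=> //.
    by move: B2; rewrite eB cards2; case: (x != _).
  by have /(blockP _ aP)[x /eqP] := Ba; rewrite none.
exists draw; split=> [B /drawP[x [y [-> exy xy eB]]]|B C /drawP[x [y [-> exy xy eB]]]].
  split.
  - exact/continuous_subspaceT/arc_continuous.
  - move=> s t _ _; move: (xy); rewrite /arc; case: (x) (y) => [i|i] [j|j] ne [] /=.
    + move=> /addrI e _; apply: mulIf e; rewrite subr_eq0 eqr_nat eq_sym.
      by apply: contra ne => /eqP/val_inj ->.
    + by move=> _; lra.
    + by move=> _; lra.
    + move=> /addrI e _; apply: mulIf e; rewrite subr_eq0 eqr_nat eq_sym.
      by apply: contra ne => /eqP/val_inj ->.
  - exists x, y; split=> //; rewrite /arc; case: (position R x) => u v;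
      case: (position R y) => u' v'; congr pair; ring.
  - move=> t; rewrite in_itv /= => t01; split; last by case: (arc_height xy t01).
    have col v : 0 <= abscissa v <= n.-1%:R.
      rewrite ler0n ler_nat; case: (n) v => [|m] [] [i im] //=; by rewrite -ltnS.
    have := col x; have := col y; rewrite /arc /abscissa.
    case: (x) (y) => [i|i] [j|j] /=; nra.
  - move=> t; rewrite in_itv /= => t01 v ev.
    have t01' : 0 <= t <= 1 by case/andP: t01 => t0 t1; rewrite !ltW.
    have [_ /(_ t01)] := arc_height xy t01'.
    by rewrite ev; case: v {ev} => i /=; rewrite ltxx ?andbF.
move=> /drawP[z [w [-> ezw zw eC]]] BC s t.
rewrite !in_itv /= => s01 t01 e.
have zx : z != x.
  apply: contraNneq BC => ezx; apply/eqP.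
  by rewrite eB eC -exy -ezw ezx.
have zy : z != y.
  apply: contraNneq BC => ezy; apply/eqP.
  by rewrite eB eC -ezw ezy (partner_swap aP exy) finset.setUC.
have D : [&& z != x, z != y, w != x & w != y].
  rewrite zx zy -ezw -{1}(partner_swap aP exy) -{2}exy !(inj_eq (can_inj (partnerK aP))).
  by rewrite zx zy.
apply: (curve_disjoint (nc x y z w exy ezw zx zy _ _) xy zw D (arc_curve _ _ s01)); rewrite 1?eq_sym //.
by rewrite e; apply: arc_curve.
Qed.

End Drawing.

(** * Noncrossing diagrams *)

Section Noncrossing.

Variable n : nat.
Implicit Types (a b p q : diagram n) (i j k l : 'I_n) (A D : {set 'I_n}).

Definition nc_monoid : {set diagram n} :=
  [set a in partial_brauer n | noncrossing a].

Lemma mem_nc a : (a \in nc_monoid) = (a \in partial_brauer n) && noncrossing a.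
Proof. by rewrite [LHS]inE. Qed.

Lemma nc_pb a : a \in nc_monoid -> a \in partial_brauer n.
Proof. by rewrite mem_nc => /andP[]. Qed.

Hint Resolve nc_pb : core.

Lemma motzkinE (R : realType) : motzkin R n = nc_monoid.
Proof.
apply/setP=> a; rewrite [LHS]inE mem_nc; apply: andb_id2l => aP.
by apply/asboolP/idP; [apply: planar_noncrossing|apply: noncrossing_planar].
Qed.

Lemma nc_dmul a b : a \in nc_monoid -> b \in nc_monoid -> dmul a b \in nc_monoid.
Proof.
rewrite !mem_nc => /andP[aP anc] /andP[bP bnc].
by rewrite dmul_pb // noncrossing_dmul.
Qed.

Lemma nc_star a : a \in nc_monoid -> dstar a \in nc_monoid.
Proof.
rewrite !mem_nc => /andP[aP /noncrossingP nc].
rewrite star_pb //=; apply/noncrossingP=> x y z w.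
have cr (u v s t : vertex n) :
    crossing (flip u) (flip v) (flip s) (flip t) = crossing u v s t.
  by rewrite /crossing /beyond; case: u v s t => [?|?] [?|?] [?|?] [?|?].
have flip_neq (u v : vertex n) : u != v -> flip u != flip v.
  by rewrite (inj_eq (can_inj (@flipK n))).
rewrite !partner_star // => /(congr1 (@flip n)) + /(congr1 (@flip n)).
rewrite !flipK -(cr x y z w) => exy ezw zx zy yx wz.
by apply: nc; rewrite ?flip_neq.
Qed.

Lemma upper_hook_inside a i j k : a \in nc_monoid ->
  partner a (upper i) = upper j -> i < k < j ->
  exists2 l, partner a (upper k) = upper l & i < l < j.
Proof.
move=> aN ij ikj; have aP := nc_pb aN.
have /noncrossingP nc : noncrossing a by move: aN; rewrite mem_nc => /andP[].
have nij : upper j != upper i by apply/eqP=> -[e]; move: ikj; rewrite e; lia.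
have nki : upper k != upper i by apply/eqP=> -[e]; move: ikj; rewrite e; lia.
have nkj : upper k != upper j by apply/eqP=> -[e]; move: ikj; rewrite e; lia.
case E : (partner a (upper k)) => [l|l].
  have ji := partner_swap aP ij.
  have nli : l != i by apply/eqP=> e; move: (partner_swap aP E) nkj; rewrite e ij => ->; rewrite eqxx.
  have nlj : l != j by apply/eqP=> e; move: (partner_swap aP E) nki; rewrite e ji => ->; rewrite eqxx.
  exists l => //; case: (eqVneq l k) => [->//|nlk].
  have := nc _ _ _ _ ij E nki nkj nij; rewrite -/(upper l) /crossing /beyond /= => /(_ _).
  rewrite (_ : upper l != upper k); last by apply: contra_neq nlk => -[].
  move=> /(_ isT); rewrite -!val_eqE /= in nli nlj *.
  by case: (leqP k i); case: (leqP k j); case: (leqP l i); case: (leqP l j) => //=; lia.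
have := nc _ _ _ _ ij E nki nkj nij isT; rewrite /crossing /beyond /= addbF.
by case: (leqP k i); case: (leqP k j) => //=; lia.
Qed.

Lemma transversal_mono a i j k l : a \in nc_monoid ->
  partner a (upper i) = lower j -> partner a (upper k) = lower l -> (i < k) = (j < l).
Proof.
move=> aN ij kl; have aP := nc_pb aN.
have /noncrossingP nc : noncrossing a by move: aN; rewrite mem_nc => /andP[].
case: (eqVneq i k) => [e|nik]; first by move: ij kl; rewrite e => -> [->]; rewrite !ltnn.
have nki : upper k != upper i by apply: contra_neq nik => -[].
have := nc _ _ _ _ ij kl nki isT isT isT; rewrite /crossing /beyond /= addbF.
have njl : j != l.
  apply: contra_neq nik => e; apply/esym/eqP; move: (partner_swap aP ij); rewrite e (partner_swap aP kl) => -[->].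
  by rewrite eqxx.
rewrite -!val_eqE /= in nik njl *.
by case: (ltngtP i k) nik; case: (ltngtP j l) njl.
Qed.

(** Transversals form an increasing bijection from the domain to the codomain, so these two sets
    determine them. *)
Lemma transversal_index a i j : a \in nc_monoid -> partner a (upper i) = lower j ->
  #|[set k in ddom a | k < i]| = #|[set l in dcodom a | l < j]|.
Proof.
move=> aN ij; have aP := nc_pb aN.
pose f k := column (partner a (upper k)).
have fE k : k \in ddom a -> partner a (upper k) = lower (f k).
  by rewrite mem_ddom // /f => /lower_column{1}->.
have -> : [set l in dcodom a | l < j] = f @: [set k in ddom a | k < i].
  apply/setP=> l; apply/setIdP/imsetP => [[/(dcodomP _ aP)[k lk] lj]|].
    have kl := partner_swap aP lk; exists k; last by rewrite /f kl.
    apply/setIdP; rewrite (transversal_mono aN kl ij); split=> //.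
    by apply/(ddomP _ aP); exists l.
  case=> k /setIdP[kd ki] ->.
  rewrite -(transversal_mono aN (fE k kd) ij); split=> //.
  by apply/(dcodomP _ aP); exists k; apply: partner_swap (fE k kd).
rewrite card_in_imset // => k l /setIdP[kd _] /setIdP[ld _] e.
suff [] : upper k = upper l by [].
by apply: (can_inj (partnerK aP)); rewrite !fE // e.
Qed.

Lemma card_below_inj A i j : i \in A -> j \in A ->
  #|[set k in A | k < i]| = #|[set k in A | k < j]| -> i = j.
Proof.
have lt k l : k \in A -> k < l -> #|[set m in A | m < k]| < #|[set m in A | m < l]|.
  move=> kA kl; apply/proper_card/properP; split.
    by apply/subsetP=> m; rewrite !inE => /andP[-> /ltn_trans/(_ kl)].
  by exists k; rewrite !inE kA ?kl ?ltnn.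
move=> iA jA e; apply/val_inj/eqP; case: ltngtP => // /lt.
  by move/(_ iA); rewrite e ltnn.
by move/(_ jA); rewrite e ltnn.
Qed.

(** A singleton [i] enters as the pair [(i, i)], so all nontransversal blocks of the row are
    recorded, and with them the complement of the domain or codomain. *)
Definition hooks (side : 'I_n -> vertex n) a : {set 'I_n * 'I_n} :=
  [set h | partner a (side h.1) == side h.2].

Lemma upper_hooksP a i j : reflect (partner a (upper i) = upper j) ((i, j) \in hooks (@upper n) a).
Proof. by rewrite inE; apply: eqP. Qed.

Lemma lower_hooksP a i j : reflect (partner a (lower i) = lower j) ((i, j) \in hooks (@lower n) a).
Proof. by rewrite inE; apply: eqP. Qed.

Lemma hooks_star a : a \in partial_brauer n -> hooks (@upper n) (dstar a) = hooks (@lower n) a.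
Proof.
move=> aP; apply/setP=> -[i j]; rewrite !inE partner_star //=.
by rewrite -(inj_eq (can_inj (@flipK n))) flipK.
Qed.

Lemma dom_hooks a b : a \in partial_brauer n -> b \in partial_brauer n ->
  hooks (@upper n) a \subset hooks (@upper n) b -> ddom b \subset ddom a.
Proof.
move=> aP bP /subsetP sub; apply/subsetP=> i; apply: contraLR.
case/(not_ddomP _ aP)=> j /upper_hooksP/sub/upper_hooksP ij.
by apply/(not_ddomP _ bP); exists j.
Qed.

Lemma eq_dom a b : a \in partial_brauer n -> b \in partial_brauer n ->
  hooks (@upper n) a = hooks (@upper n) b -> ddom a = ddom b.
Proof. by move=> aP bP e; apply/eqP; rewrite eqEsubset !dom_hooks // e. Qed.

Lemma eq_codom a b : a \in partial_brauer n -> b \in partial_brauer n ->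
  hooks (@lower n) a = hooks (@lower n) b -> dcodom a = dcodom b.
Proof.
by move=> aP bP e; rewrite -!dom_star //; apply: eq_dom; rewrite ?star_pb ?hooks_star.
Qed.

(** More hooks mean a smaller domain, so the cardinalities make the domains equal. Every vertex in a
    hook of [b] then already lies in a hook of [a], which is the same one by inclusion. *)
Lemma eq_hooks a b : a \in partial_brauer n -> b \in partial_brauer n ->
  hooks (@upper n) a \subset hooks (@upper n) b -> #|ddom a| <= #|ddom b| ->
  hooks (@upper n) a = hooks (@upper n) b.
Proof.
move=> aP bP sub card; have := dom_hooks aP bP sub => sd.
have /eqP ed : ddom b == ddom a by rewrite eqEcard sd.
apply/eqP; rewrite eqEsubset sub; apply/subsetP=> -[i j] /upper_hooksP ij.
have : i \notin ddom a by rewrite -ed; apply/(not_ddomP _ bP); exists j.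
case/(not_ddomP _ aP)=> j' /upper_hooksP ij'.
have /upper_hooksP := subsetP sub _ ij'.
by rewrite ij => -[->].
Qed.

Lemma eq_nc a b : a \in nc_monoid -> b \in nc_monoid ->
  hooks (@upper n) a = hooks (@upper n) b -> hooks (@lower n) a = hooks (@lower n) b ->
  a = b.
Proof.
move=> aN bN eU eL; have aP := nc_pb aN; have bP := nc_pb bN.
have trans i j : partner a (upper i) = lower j -> partner b (upper i) = lower j.
  move=> ij; have iA : i \in ddom a by apply/(ddomP _ aP); exists j.
  have jA : j \in dcodom a by apply/(dcodomP _ aP); exists i; apply: partner_swap.
  have [k ik] : exists k, partner b (upper i) = lower k.
    by apply/(ddomP _ bP); rewrite -(eq_dom aP bP eU).
  have kA : k \in dcodom b by apply/(dcodomP _ bP); exists i; apply: partner_swap.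
  rewrite ik; congr lower; apply: (card_below_inj (A := dcodom a)) => //.
    by rewrite (eq_codom aP bP eL).
  rewrite -(transversal_index aN ij) {1}(eq_codom aP bP eL) -(transversal_index bN ik).
  by rewrite (eq_dom aP bP eU).
apply: eq_diagram => // -[i|i].
  case E : (partner a (inl i)) => [j|j]; apply/esym.
    by apply/upper_hooksP; rewrite -eU; apply/upper_hooksP.
  exact: trans.
case E : (partner a (inr i)) => [j|j]; apply/esym.
  by apply: (partner_swap bP); apply: trans; apply: partner_swap.
by apply/lower_hooksP; rewrite -eL; apply/lower_hooksP.
Qed.

End Noncrossing.

(** * Projections *)

(* Otherwise [done] compares diagrams by unfolding their products. *)
Opaque dmul dstar.

Section Projections.

Variable n : nat.
Implicit Types (a b c p q : diagram n) (i j k l m : 'I_n) (A D : {set 'I_n}).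

Hint Resolve nc_pb : core.

Lemma hooks_dmul a b : a \in partial_brauer n -> b \in partial_brauer n ->
  hooks (@upper n) a \subset hooks (@upper n) (dmul a b).
Proof.
move=> aP bP; apply/subsetP=> -[i j] /upper_hooksP ij.
by apply/upper_hooksP/dmul_upper.
Qed.

Lemma lower_hooks_dmul a b : a \in partial_brauer n -> b \in partial_brauer n ->
  hooks (@lower n) b \subset hooks (@lower n) (dmul a b).
Proof.
move=> aP bP; apply/subsetP=> -[i j] /lower_hooksP ij.
by apply/lower_hooksP/dmul_lower.
Qed.

Lemma dom_dmul a b : a \in partial_brauer n -> b \in partial_brauer n ->
  ddom (dmul a b) \subset ddom a.
Proof. by move=> aP bP; apply: dom_hooks (hooks_dmul aP bP); rewrite ?dmul_pb. Qed.

Lemma codom_dmul a b : a \in partial_brauer n -> b \in partial_brauer n ->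
  dcodom (dmul a b) \subset dcodom b.
Proof.
move=> aP bP; rewrite -!dom_star ?dmul_pb // -dmul_star //.
by apply: dom_dmul; rewrite star_pb.
Qed.

Lemma partner_dom a i : a \in partial_brauer n -> i \in ddom a ->
  exists2 j, partner a (upper i) = lower j & j \in dcodom a.
Proof.
move=> aP /(ddomP _ aP)[j ij]; exists j => //.
by apply/(dcodomP _ aP); exists i; apply: partner_swap.
Qed.

Lemma partner_codom a j : a \in partial_brauer n -> j \in dcodom a ->
  exists2 i, partner a (upper i) = lower j & i \in ddom a.
Proof.
move=> aP /(dcodomP _ aP)[i /(partner_swap aP) ij]; exists i => //.
by apply/(ddomP _ aP); exists j.
Qed.

Lemma dom_dmul_codom a b : a \in partial_brauer n -> b \in partial_brauer n ->
  dcodom a = ddom b -> ddom (dmul a b) = ddom a /\ dcodom (dmul a b) = dcodom b.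
Proof.
move=> aP bP e; split; apply/eqP; rewrite eqEsubset ?dom_dmul ?codom_dmul //=.
  apply/subsetP=> i /(partner_dom aP)[j ij]; rewrite e => /(partner_dom bP)[k jk _].
  by apply/ddomP; [exact: dmul_pb|exists k; apply: dmul_transversal ij jk].
apply/subsetP=> k /(partner_codom bP)[j jk]; rewrite -e => /(partner_codom aP)[i ij _].
apply/dcodomP; [exact: dmul_pb|exists i].
by apply: (partner_swap (dmul_pb aP bP)); apply: dmul_transversal ij jk.
Qed.

(** Domain and codomain coincide, and a transversal preserves the index in them. *)
Lemma symmetric_straight p i :
  p \in nc_monoid n -> dstar p = p -> i \in ddom p -> partner p (upper i) = lower i.
Proof.
move=> pN sym ip; have pP := nc_pb pN.
have ed : dcodom p = ddom p by rewrite -dom_star // sym.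
have [j ij jc] := partner_dom pP ip; rewrite ij; congr lower.
rewrite ed in jc; apply: (card_below_inj jc ip).
by rewrite (transversal_index pN ij) ed.
Qed.

Lemma symmetric_lower p x : p \in partial_brauer n -> dstar p = p ->
  partner p (flip x) = flip (partner p x).
Proof. by move=> pP sym; rewrite -{1}sym partner_star // flipK. Qed.

Lemma symmetric_codom p : p \in partial_brauer n -> dstar p = p -> dcodom p = ddom p.
Proof. by move=> pP sym; rewrite -dom_star // sym. Qed.

Lemma symmetric_hooks p : p \in partial_brauer n -> dstar p = p ->
  hooks (@lower n) p = hooks (@upper n) p.
Proof. by move=> pP sym; rewrite -hooks_star // sym. Qed.

Lemma symmetric_eq p q : p \in nc_monoid n -> q \in nc_monoid n ->
  dstar p = p -> dstar q = q -> hooks (@upper n) p = hooks (@upper n) q -> p = q.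
Proof.
move=> pN qN sp sq e; apply: eq_nc => //.
by rewrite !symmetric_hooks // nc_pb.
Qed.

(** The square is again symmetric, contains the hooks of [p] and has the same domain. *)
Lemma symmetric_idempotent p : p \in nc_monoid n -> dstar p = p -> dmul p p = p.
Proof.
move=> pN sym; have pP := nc_pb pN.
have ppN : dmul p p \in nc_monoid n by apply: nc_dmul.
have pp_sym : dstar (dmul p p) = dmul p p by rewrite -(dmul_star pP pP) sym.
symmetry; apply: (symmetric_eq pN ppN sym pp_sym).
apply: (eq_hooks pP (nc_pb ppN) (hooks_dmul pP pP)).
by have [-> _] := dom_dmul_codom pP pP (symmetric_codom pP sym).
Qed.

Lemma projectionE p : p \in nc_monoid n -> projection p = (dstar p == p).
Proof.
by move=> pN; apply: andb_idr => /eqP sym; rewrite symmetric_idempotent.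
Qed.

(** The unique projection in the R-class of a noncrossing [a]. *)
Definition proj a := dmul a (dstar a).

Lemma proj_nc a : a \in nc_monoid n -> proj a \in nc_monoid n.
Proof. by move=> aN; apply: nc_dmul => //; apply: nc_star. Qed.

Lemma proj_star a : a \in partial_brauer n -> dstar (proj a) = proj a.
Proof. by move=> aP; rewrite -(dmul_star aP (star_pb aP)) (starK aP). Qed.

Lemma dom_proj a : a \in partial_brauer n -> ddom (proj a) = ddom a.
Proof.
by move=> aP; have [] := dom_dmul_codom aP (star_pb aP) (esym (dom_star aP)).
Qed.

Lemma hooks_proj a : a \in partial_brauer n ->
  hooks (@upper n) (proj a) = hooks (@upper n) a.
Proof.
move=> aP; have sP := star_pb aP; symmetry.
by apply: (eq_hooks aP (dmul_pb aP sP) (hooks_dmul aP sP)); rewrite dom_proj.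
Qed.

(** * Projections with prescribed hooks and domain *)

Section Pattern.

Variables (s : 'I_n -> 'I_n) (D : {set 'I_n}).
Hypotheses (sK : involutive s) (sD : {in D, forall i, s i = i}).
Hypothesis nested_s : forall i k, i < k < s i -> (k \notin D) && (i < s k < s i).

Let pattern_fun (x : vertex n) : vertex n :=
  match x with
  | inl i => if i \in D then lower i else upper (s i)
  | inr i => if i \in D then upper i else lower (s i)
  end.

Definition pattern : diagram n := diagram_of pattern_fun.

Let s_in i : (s i \in D) = (i \in D).
Proof. by apply/idP/idP=> iD; [rewrite -[i]sK|]; rewrite sD. Qed.

Let pattern_funK : involutive pattern_fun.
Proof.
by case=> i /=; case: ifP => iD /=; rewrite ?s_in iD ?sK.
Qed.

Lemma pattern_pb : pattern \in partial_brauer n.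
Proof. exact: diagram_of_pb. Qed.

Lemma partner_pattern i :
  partner pattern (upper i) = if i \in D then lower i else upper (s i).
Proof. by rewrite partner_diagram_of. Qed.

Lemma pattern_dom : ddom pattern = D.
Proof.
apply/setP=> i; rewrite mem_ddom ?pattern_pb // partner_pattern.
by case: ifP.
Qed.

Lemma pattern_star : dstar pattern = pattern.
Proof.
apply: eq_diagram; rewrite ?star_pb ?pattern_pb // => x.
rewrite partner_star ?pattern_pb // !partner_diagram_of //.
by case: x => i /=; case: ifP.
Qed.

Lemma pattern_nc : pattern \in nc_monoid n.
Proof.
rewrite mem_nc pattern_pb /=; apply/noncrossingP=> x y z w.
rewrite !partner_diagram_of // => <- <-.
pose within i k := (i < k < s i) || (s i < k < i).
have withinE i k : k != i -> k != s i -> (k <= i) (+) (k <= s i) = within i k.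
  rewrite /within -!val_eqE /=; move: (nat_of_ord i) (nat_of_ord k) (nat_of_ord (s i)).
  by move=> i' k' s'; case: (ltngtP k' i'); case: (ltngtP k' s').
have within_s i k : within i k -> within i (s k).
  case/orP=> [/nested_s/andP[_ ?]|]; first by apply/orP; left.
  by rewrite -{2}[i]sK => /nested_s/andP[_]; rewrite sK => ?; apply/orP; right.
have line i k : i \notin D -> k \in D -> (k <= i) = (k <= s i).
  move=> iD kD; have ki : k != i by apply: contraNneq iD => <-.
  have ksi : k != s i by rewrite -s_in in iD; apply: contraNneq iD => <-.
  have : within i k = false; last first.
    by rewrite -(withinE i k ki ksi); case: (k <= i); case: (k <= s i).
  apply/negP=> /orP[/nested_s|]; first by rewrite kD.
  by rewrite -{2}[i]sK => /nested_s; rewrite kD.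
have line' i k : i \in D -> k \notin D -> (k <= i) = (s k <= i).
  move=> iD kD; have := line k i kD iD.
  have ki : i != k by apply: contraNneq kD => <-.
  have ksi : i != s k by rewrite -s_in in kD; apply: contraNneq kD => <-.
  rewrite -!val_eqE /= in ki ksi; move: ki ksi; clear.
  move: (nat_of_ord i) (nat_of_ord k) (nat_of_ord (s k)) => i' k' s'.
  by case: (ltngtP i' k'); case: (ltngtP i' s').
(* [k] and [s k] lie both inside or both outside the hook of [i]. *)
have two i k : k != i -> k != s i ->
    ((k <= i) (+) (k <= s i)) (+) ((s k <= i) (+) (s k <= s i)) = false.
  move=> ki ksi; rewrite (withinE i k ki ksi) (withinE i (s k)).
  - suff -> : within i (s k) = within i k by rewrite addbb.
    by apply/idP/idP=> /within_s; rewrite ?sK.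
  - by apply: contraNneq ksi => <-; rewrite sK.
  - by rewrite (inj_eq (can_inj sK)).
rewrite /crossing /beyond; case: x => i; case: z => k; rewrite /=;
  case: (boolP (i \in D)) => iD; case: (boolP (k \in D)) => kD /= zx zy _ _;
  rewrite ?(line _ _ iD kD) ?(line' _ _ iD kD) ?addbF ?addbb //.
- by apply: two; [move: zx|move: zy]; apply: contraNneq => ->.
- by apply: two; [move: zx|move: zy]; apply: contraNneq => ->.
Qed.

End Pattern.

End Projections.

(** * R-classes *)

Opaque partner.

Section Rclasses.

Variable n : nat.
Implicit Types (a b c p q : diagram n) (i j k l m : 'I_n).

(** Going down and up again through [b] restores every vertex of its domain, and the remaining upper
    blocks of [b] are blocks of [c] by assumption. The bracketing exhibits [c] as a right multiple
    of [b]. *)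
Lemma dmul_star_cancel b c : b \in partial_brauer n -> c \in partial_brauer n ->
  hooks (@upper n) b \subset hooks (@upper n) c -> dmul b (dmul (dstar b) c) = c.
Proof.
move=> bP cP /subsetP sub; have sP := star_pb bP; have dP := dmul_pb sP cP.
have up i : partner (dmul b (dmul (dstar b) c)) (upper i) = partner c (upper i).
  case E : (partner b (upper i)) => [j|j].
    rewrite (dmul_upper bP dP E); symmetry.
    by have /upper_hooksP := sub (i, j) (introT (upper_hooksP _ _ _) E).
  have ji : partner (dstar b) (upper j) = lower i.
    by rewrite partner_star //= (partner_swap bP E).
  case F : (partner c (upper i)) => [l|k]; last first.
    exact: (dmul_transversal bP dP E (dmul_transversal sP cP ji F)).
  case G : (partner b (upper l)) => [m|m].
    have /upper_hooksP := sub (l, m) (introT (upper_hooksP _ _ _) G).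
    by rewrite (partner_swap cP F) => -[im]; move: (partner_swap bP G); rewrite -im E.
  have lm : partner (dstar b) (lower l) = upper m by rewrite partner_star //= G.
  exact: (dmul_hook bP dP E (dmul_hook sP cP ji F lm) (partner_swap bP G)).
apply: (eq_diagram (dmul_pb bP dP) cP) => -[i|k]; first exact: up.
case E : (partner c (inr k)) => [i|l].
  by apply: (partner_swap (dmul_pb bP dP)); rewrite up; apply: partner_swap.
exact: (dmul_lower bP dP (dmul_lower sP cP E)).
Qed.

Definition full_id : diagram n := pattern id [set: 'I_n].

Lemma full_id_nc : full_id \in nc_monoid n.
Proof. by apply: pattern_nc => // i k /andP[ik ki]; have := ltn_trans ik ki; rewrite ltnn. Qed.

Lemma dmul_full_id a : a \in partial_brauer n -> dmul a full_id = a.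
Proof.
move=> aP; have oP := nc_pb full_id_nc.
have id_up i : partner full_id (upper i) = lower i by rewrite partner_pattern // inE.
have id_low i := partner_swap oP (id_up i).
apply: (eq_diagram (dmul_pb aP oP) aP) => -[i|i].
  case E : (partner a (inl i)) => [j|j]; first exact: (dmul_upper aP oP E).
  exact: (dmul_transversal aP oP E (id_up j)).
case E : (partner a (inr i)) => [j|j].
  apply: (partner_swap (dmul_pb aP oP)).
  exact: (dmul_transversal aP oP (partner_swap aP E) (id_up i)).
exact: (dmul_lower_hook aP oP (id_low i) E (id_up j)).
Qed.

Lemma right_mul_hooks a b : a \in nc_monoid n -> b \in nc_monoid n ->
  (right_mul (@dmul n) a (nc_monoid n) == right_mul (@dmul n) b (nc_monoid n)) =
  (hooks (@upper n) a == hooks (@upper n) b).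
Proof.
have in_mul c d : c \in nc_monoid n -> d \in nc_monoid n ->
    c \in right_mul (@dmul n) d (nc_monoid n) -> hooks (@upper n) d \subset hooks (@upper n) c.
  by move=> cN dN /imsetP[y yN ->]; apply: hooks_dmul; apply: nc_pb.
have self c : c \in nc_monoid n -> c \in right_mul (@dmul n) c (nc_monoid n).
  move=> cN; apply/imsetP; exists full_id; first exact: full_id_nc.
  by rewrite (dmul_full_id (nc_pb cN)).
have sub c d : c \in nc_monoid n -> d \in nc_monoid n ->
    hooks (@upper n) c = hooks (@upper n) d ->
    right_mul (@dmul n) c (nc_monoid n) \subset right_mul (@dmul n) d (nc_monoid n).
  move=> cN dN e; apply/subsetP=> _ /imsetP[y yN ->].
  have cyN := nc_dmul cN yN; apply/imsetP.
  exists (dmul (dstar d) (dmul c y)); first exact: (nc_dmul (nc_star dN) cyN).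
  rewrite (dmul_star_cancel (nc_pb dN) (nc_pb cyN)) // -e.
  exact: (hooks_dmul (nc_pb cN) (nc_pb yN)).
move=> aN bN; apply/eqP/eqP=> e; apply/eqP; rewrite eqEsubset; last first.
  by apply/andP; split; [exact: (sub a b aN bN e)|exact: (sub b a bN aN (esym e))].
apply/andP; split; [apply: (in_mul b a bN aN)|apply: (in_mul a b aN bN)].
  by rewrite e; apply: self.
by rewrite -e; apply: self.
Qed.

Definition projections r : {set diagram n} :=
  [set p in nc_monoid n | (dstar p == p) && (drank p == r)].

Lemma projectionsP r p : reflect
  [/\ p \in nc_monoid n, dstar p = p & #|ddom p| = r] (p \in projections r).
Proof.
apply: (iffP setIdP) => [[pN /andP[/eqP sym /eqP rk]]|[pN sym rk]].
  by split=> //; rewrite -drankE ?nc_pb.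
by rewrite sym eqxx drankE ?nc_pb // rk eqxx.
Qed.

Lemma proj_projections a : a \in nc_monoid n -> proj a \in projections #|ddom a|.
Proof.
move=> aN; apply/projectionsP; split; first exact: proj_nc.
  exact: proj_star (nc_pb aN).
by rewrite dom_proj // nc_pb.
Qed.

Lemma num_RclassesE (R : realType) r : num_Rclasses R n r = #|projections r|.
Proof.
rewrite /num_Rclasses /motzkin_D motzkinE; set M := nc_monoid n.
pose class p := [set b in M | hooks (@upper n) p == hooks (@upper n) b].
have D_r a : (a \in [set a in M | drank a == r]) = (a \in M) && (#|ddom a| == r).
  by rewrite in_set; apply: andb_id2l => aN; rewrite drankE ?nc_pb.
have -> : [set C in Rclasses (@dmul n) M | C \subset [set a in M | drank a == r]] =
    class @: projections r.
  have classE p : p \in M ->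
      [set b in M | right_mul (@dmul n) p M == right_mul (@dmul n) b M] = class p.
    move=> pN; apply/setP=> b; rewrite [LHS]in_set [RHS]in_set; apply: andb_id2l => bN.
    exact: (right_mul_hooks pN bN).
  apply/setP=> C; apply/setIdP/imsetP => [[/imsetP[a aM ->] sub]|[p pr ->]].
    rewrite classE // in sub *.
    have : a \in class a by rewrite in_set aM eqxx.
    move/(subsetP sub); rewrite D_r aM => /eqP <-.
    exists (proj a); first exact: proj_projections.
    by rewrite /class hooks_proj // nc_pb.
  have /projectionsP[pN _ rk] := pr; split.
    by apply/imsetP; exists p; rewrite ?classE.
  apply/subsetP=> b /setIdP[bN /eqP e]; rewrite D_r bN -rk /=.
  by rewrite (eq_dom (nc_pb pN) (nc_pb bN) e).
apply: card_in_imset => p q /projectionsP[pN sp _] /projectionsP[qN sq _] e.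
apply: symmetric_eq => //; apply/eqP.
have : q \in class q by rewrite in_set qN eqxx.
by rewrite -e in_set qN.
Qed.

End Rclasses.

(** * Cosparse domains *)

Section Generated.

Variables (T : finType) (op : T -> T -> T).
Implicit Types (A B : {set T}).

Lemma mul_closedP B :
  reflect {in B &, forall x y, op x y \in B} (mul_closed op B).
Proof.
apply: (iffP forall_inP) => [H x y xB yB|H x xB].
  by have /forall_inP := H x xB; apply.
by apply/forall_inP=> y; apply: H.
Qed.

Lemma sub_generated A : A \subset generated op A.
Proof. by apply/bigcapsP=> B /andP[]. Qed.

Lemma generated_min A B : A \subset B -> mul_closed op B -> generated op A \subset B.
Proof. by move=> AB cB; apply: bigcap_inf; rewrite AB. Qed.

Lemma generated_closed A : mul_closed op (generated op A).
Proof.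
apply/mul_closedP=> x y /bigcapP xB /bigcapP yB; apply/bigcapP=> B BA.
by case/andP: (BA) => _ /mul_closedP; apply; [apply: xB|apply: yB].
Qed.

(** The elements of [B] outside [P] are closed under products, so a set avoiding [P] generates
    nothing in [P]. *)
Lemma mem_generated_sub A B x : generated op A = B -> x \in B ->
  mul_closed op B -> forall P : pred T, P x ->
  {in B &, forall y z, P (op y z) -> P y} -> exists2 y, y \in A & P y.
Proof.
move=> gA xB cB P Px prime_P; case: (boolP [exists y in A, P y]) => [/exists_inP //|].
rewrite negb_exists_in => /forall_inP none.
have: x \in B :\: [set y | P y].
  apply: subsetP xB; rewrite -{1}gA; apply: generated_min.
    apply/subsetP=> y yA; rewrite !inE none //= -gA.
    exact: subsetP (sub_generated A) _ yA.
  apply/mul_closedP=> y z; rewrite !inE => /andP[nPy yB] /andP[_ zB].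
  by rewrite (contra (prime_P _ _ yB zB) nPy) (mul_closedP _ cB).
by rewrite !inE Px.
Qed.

End Generated.

Section Cosparse.

Variable n : nat.
Implicit Types (a b c p q : diagram n) (i j k l m : 'I_n) (A B D : {set 'I_n}).

Lemma not_cosparseP A :
  reflect (exists i j, [/\ j = i.+1 :> nat, i \notin A & j \notin A]) (~~ cosparse A).
Proof.
apply: (iffP forallPn) => [[i /forallPn[j]]|[i [j [ij iA jA]]]].
  rewrite !negb_imply => /and3P[/eqP ij iA jA]; exists i, j.
  by move: iA jA; rewrite !in_setC andbT ?negbK; split.
exists i; apply/forallPn; exists j; rewrite !negb_imply !in_setC iA jA /= andbT.
by apply/eqP.
Qed.

Lemma cosparseS A B : A \subset B -> cosparse A -> cosparse B.
Proof.
move=> /subsetP AB; apply: contraTT => /not_cosparseP[i [j [ij iB jB]]].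
by apply/not_cosparseP; exists i, j; rewrite ij (contra (AB i)) // (contra (AB j)).
Qed.

(** A hook from [u] to [v > u] would put the adjacent column [u + 1] outside the domain as well: it
    is [v] or lies under the hook. *)
Lemma cosparse_upper a i : a \in nc_monoid n -> cosparse (ddom a) ->
  i \notin ddom a -> partner a (upper i) = upper i.
Proof.
move=> aN cos iN; have aP := nc_pb aN.
have no_hook (u v : 'I_n) : u < v -> partner a (upper u) <> upper v.
  move=> uv huv; have u1 : u.+1 < n by apply: leq_ltn_trans (ltn_ord v).
  suff : ~~ cosparse (ddom a) by rewrite cos.
  apply/not_cosparseP; exists u, (Ordinal u1); split=> //.
    by apply/(not_ddomP _ aP); exists v.
  apply/(not_ddomP _ aP); case: (ltngtP u.+1 v) => [lt|gt|e].
  - have lt' : u < Ordinal u1 < v by rewrite /= ltnSn.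
    by have [l ul _] := upper_hook_inside aN huv lt'; exists l.
  - by move: uv; rewrite ltnNge -ltnS gt.
  - exists u; rewrite (_ : Ordinal u1 = v); last exact: val_inj.
    exact: partner_swap.
have [j ij] := not_ddomP _ aP iN; case: (ltngtP i j) => [lt|lt|/val_inj e].
- by case: (no_hook _ _ lt ij).
- by case: (no_hook _ _ lt (partner_swap aP ij)).
- by rewrite ij e.
Qed.

Lemma id_nested D i k : i < k < id i -> (k \notin D) && (i < id k < id i).
Proof. by case/andP=> ik /(ltn_trans ik); rewrite ltnn. Qed.

Definition partial_id D : diagram n := pattern id D.

Lemma partial_id_nc D : partial_id D \in nc_monoid n.
Proof. by apply: pattern_nc => // i k /id_nested; apply. Qed.

Lemma partial_id_upper D i :
  partner (partial_id D) (upper i) = if i \in D then lower i else upper i.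
Proof. exact: partner_pattern. Qed.

Lemma partial_id_lower D i :
  partner (partial_id D) (lower i) = if i \in D then upper i else lower i.
Proof.
have pN := partial_id_nc D.
have := symmetric_lower (upper i) (nc_pb pN) (pattern_star (fun=> erefl) (fun _ _ => erefl)).
by rewrite /= partial_id_upper => ->; case: ifP.
Qed.

Lemma partial_id_star D : dstar (partial_id D) = partial_id D.
Proof. exact: pattern_star. Qed.

Lemma partial_id_dom D : ddom (partial_id D) = D.
Proof. exact: pattern_dom. Qed.

Lemma partial_id_codom D : dcodom (partial_id D) = D.
Proof.
by rewrite (symmetric_codom (nc_pb (partial_id_nc D)) (partial_id_star D)) partial_id_dom.
Qed.

Lemma partial_id_hooks a D : a \in nc_monoid n -> cosparse (ddom a) -> ddom a = D ->
  hooks (@upper n) a = hooks (@upper n) (partial_id D).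
Proof.
move=> aN cos <-; apply: (eq_hooks (nc_pb aN) (nc_pb (partial_id_nc _))).
  apply/subsetP=> -[i j] /upper_hooksP ij; apply/upper_hooksP.
  have iN : i \notin ddom a by apply/not_ddomP; [exact: nc_pb|exists j].
  by rewrite partial_id_upper (negPf iN) -ij (cosparse_upper aN cos iN).
by rewrite partial_id_dom.
Qed.

Lemma didE D : did D = partial_id D.
Proof.
apply/setP=> B; rewrite /did; apply/setUP/imsetP => [[/setUP[]|]|].
- by case/imsetP=> i iD ->; exists (upper i); rewrite //= iD.
- case/imsetP=> i; rewrite inE => iD ->; exists (upper i) => //=.
  by rewrite (negPf iD) setUid.
- case/imsetP=> i; rewrite inE => iD ->; exists (lower i) => //=.
  by rewrite (negPf iD) setUid.
case=> -[i|i] _ /=; case: ifP => iD ->.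
- by left; apply/setUP; left; apply/imsetP; exists i.
- by left; apply/setUP; right; apply/imsetP; exists i; rewrite ?inE ?iD // setUid.
- by left; apply/setUP; left; apply/imsetP; exists i; rewrite // setUC.
- by right; apply/imsetP; exists i; rewrite ?inE ?iD // setUid.
Qed.

(** A transversal from [i] ending at some [j] outside the domain would die in the second factor at
    the singleton [j], although it survives in [e e = e]. So the codomain equals the domain, is
    cosparse too, and there are no hooks in either row. *)
Lemma idempotent_cosparse e : e \in nc_monoid n -> dmul e e = e ->
  cosparse (ddom e) -> e = partial_id (ddom e).
Proof.
move=> eN ee cos; have eP := nc_pb eN.
have sub : dcodom e \subset ddom e.
  apply/subsetP=> j jc; apply: contraT => jd.
  have [i ij id] := partner_codom eP jc.
  have := dmul_hook eP eP ij (cosparse_upper eN cos jd) (partner_swap eP ij).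
  by rewrite ee ij.
have ed : dcodom e = ddom e by apply/eqP; rewrite eqEcard sub (card_dom_codom eP) leqnn.
have up := partial_id_hooks eN cos erefl.
apply: (eq_nc eN (partial_id_nc _) up).
rewrite -(hooks_star eP) -(hooks_star (nc_pb (partial_id_nc _))) partial_id_star.
by apply: (partial_id_hooks (nc_star eN)); rewrite dom_star // ed.
Qed.

End Cosparse.

(** * Lower bound *)

Section IdealE.

Variable n : nat.
Implicit Types (a b c p q : diagram n) (i j k l m : 'I_n) (A B D : {set 'I_n}).

(** A path entering a hook of [b] either returns through the partial identity or dies there; it
    never gets back into [b]. For a general first factor a zigzag could. *)
Lemma dom_partial_id_mul A b : b \in partial_brauer n ->
  ddom (dmul (partial_id A) b) \subset ddom b.
Proof.
move=> bP; have pP := nc_pb (partial_id_nc A).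
apply/subsetP=> i ic; have iA : i \in A.
  by rewrite -(partial_id_dom A); apply: subsetP ic; apply: dom_dmul.
apply: contraTT ic => /(not_ddomP _ bP)[l il].
have ii : partner (partial_id A) (upper i) = lower i by rewrite partial_id_upper iA.
apply/(not_ddomP _ (dmul_pb pP bP)).
case: (boolP (l \in A)) => lA; [exists l|exists i].
  by apply: (dmul_hook pP bP ii il); rewrite partial_id_lower lA.
by apply: (dmul_dead pP bP ii il); rewrite partial_id_lower (negPf lA).
Qed.

Lemma codom_mul_partial_id a B : a \in partial_brauer n ->
  dcodom (dmul a (partial_id B)) \subset dcodom a.
Proof.
move=> aP; have pP := nc_pb (partial_id_nc B).
rewrite -(dom_star (dmul_pb aP pP)) -(dmul_star aP pP) partial_id_star -(dom_star aP).
exact: dom_partial_id_mul (star_pb aP).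
Qed.

Lemma partial_id_mul A B : dmul (partial_id A) (partial_id B) = partial_id (A :&: B).
Proof.
have aP := nc_pb (partial_id_nc A); have bP := nc_pb (partial_id_nc B).
have cP := nc_pb (partial_id_nc (A :&: B)).
apply: (eq_diagram (dmul_pb aP bP) cP) => -[i|i].
  rewrite (partial_id_upper (A :&: B) i) in_setI.
  case: (boolP (i \in A)) => iA /=; last first.
    by apply: (dmul_upper aP bP); rewrite partial_id_upper (negPf iA).
  have ii : partner (partial_id A) (upper i) = lower i by rewrite partial_id_upper iA.
  case: (boolP (i \in B)) => iB.
    by apply: (dmul_transversal aP bP ii); rewrite partial_id_upper iB.
  apply: (dmul_hook aP bP ii (k := i)); first by rewrite partial_id_upper (negPf iB).
  by rewrite partial_id_lower iA.
rewrite (partial_id_lower (A :&: B) i) in_setI.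
case: (boolP (i \in B)) => iB; rewrite ?andbF ?andbT; last first.
  by apply: (dmul_lower aP bP); rewrite partial_id_lower (negPf iB).
have ii : partner (partial_id B) (upper i) = lower i by rewrite partial_id_upper iB.
case: (boolP (i \in A)) => iA.
  apply: (partner_swap (dmul_pb aP bP)); apply: (dmul_transversal aP bP _ ii).
  by rewrite partial_id_upper iA.
apply: (dmul_lower_hook aP bP (partner_swap bP ii) (k := i)) => //.
by rewrite partial_id_lower (negPf iA).
Qed.

Variable r : nat.

Definition E_set : {set diagram n} :=
     [set did A | A : {set 'I_n} & cosparse A && (#|A| <= r)]
 :|: [set a in nc_monoid n | (#|ddom a| <= r) &&
        (~~ cosparse (ddom a) && ~~ cosparse (dcodom a))].

Lemma E_setP a : reflect
  [/\ a \in nc_monoid n, #|ddom a| <= r &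
     (~~ cosparse (ddom a) /\ ~~ cosparse (dcodom a)) \/
     (cosparse (ddom a) /\ a = partial_id (ddom a))]
  (a \in E_set).
Proof.
apply: (iffP setUP) => [[/imsetP[A] + ->|/setIdP[aN /and3P[rk nd nc]]]|[aN rk []]].
- rewrite inE didE => /andP[cA rA]; rewrite partial_id_dom.
  by split=> //; [exact: partial_id_nc|right].
- by split=> //; left.
- by move=> [nd nc]; right; apply/setIdP; rewrite rk nd nc.
move=> [cos ea]; left; apply/imsetP; exists (ddom a); first by rewrite inE cos.
by rewrite didE.
Qed.

(** Subsets of noncosparse sets are noncosparse. A partial identity passes a shrunken domain or
    codomain of the other factor on, so one noncosparse factor spoils both ends of the product. *)
Lemma E_set_closed : mul_closed (@dmul n) E_set.
Proof.
apply/mul_closedP=> a b /E_setP[aN ra Ea] /E_setP[bN rb Eb].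
have aP := nc_pb aN; have bP := nc_pb bN; have cN := nc_dmul aN bN.
have rc : #|ddom (dmul a b)| <= r.
  exact: leq_trans (subset_leq_card (dom_dmul aP bP)) ra.
have noncos A B : A \subset B -> ~~ cosparse B -> ~~ cosparse A.
  by move=> AB; apply: contra; apply: cosparseS.
case: Ea Eb => [[nda nca]|[cda ea]] [[ndb ncb]|[cdb eb]].
- apply/E_setP; split=> //; left; split.
    exact: noncos (dom_dmul aP bP) nda.
  exact: noncos (codom_dmul aP bP) ncb.
- apply/E_setP; split=> //; left; split; first exact: noncos (dom_dmul aP bP) nda.
  by rewrite eb; apply: noncos (codom_mul_partial_id _ aP) nca.
- apply/E_setP; split=> //; left; split; last exact: noncos (codom_dmul aP bP) ncb.
  by rewrite ea; apply: noncos (dom_partial_id_mul _ bP) ndb.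
move: rc; rewrite ea eb partial_id_mul partial_id_dom => rc.
apply/E_setP; rewrite partial_id_dom partial_id_codom.
split=> //; first exact: partial_id_nc.
by case: (boolP (cosparse (ddom a :&: ddom b))) => cos; [right|left].
Qed.

Lemma idempotent_E_set a : a \in nc_monoid n -> #|ddom a| <= r -> dmul a a = a ->
  a \in E_set.
Proof.
move=> aN ra aa; have aP := nc_pb aN.
case: (boolP (cosparse (ddom a))) => cos.
  by apply/E_setP; split=> //; right; split=> //; apply: idempotent_cosparse.
apply/E_setP; split=> //; left; split=> //; apply: contraNN cos => cos.
have sN := nc_star aN; rewrite -(dom_star aP) in cos.
have ss : dmul (dstar a) (dstar a) = dstar a by rewrite (dmul_star aP aP) aa.
have ea : a = partial_id (ddom (dstar a)).
  by rewrite -{1}(starK aP) (idempotent_cosparse sN ss cos) partial_id_star partial_id_dom.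
by rewrite ea partial_id_dom.
Qed.

Lemma projections_E_set (d : nat) : d <= r -> projections n d \subset E_set.
Proof.
move=> kr; apply/subsetP=> p /projectionsP[pN sym rk].
by apply: idempotent_E_set; rewrite ?rk //; apply: symmetric_idempotent.
Qed.

Lemma no_unnestedP p : p \in nc_monoid n -> dstar p = p -> reflect
  (forall i, partner p (upper i) = upper i ->
     exists u v, partner p (upper u) = upper v /\ u < i < v)
  (no_unnested_singletons p).
Proof.
move=> pN sym; have pP := nc_pb pN.
have sing side i : injective side -> nested side p [set side i] =
    [exists u : 'I_n, exists v : 'I_n,
       ([set side u; side v] \in edges p) && (u < i < v)].
  move=> inj; rewrite /nested; apply: eq_existsb => u; apply: eq_existsb => v.
  congr (_ && _); apply/forall_inP/idP=> [->//|uiv j]; first by rewrite inE.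
  by rewrite inE => /eqP/inj ->.
have edgeE (u v : 'I_n) : u < v -> (([set upper u; upper v] \in edges p) = (partner p (upper u) == upper v))
     /\ (([set lower u; lower v] \in edges p) = (partner p (upper u) == upper v)).
  move=> uv; have uv' : u != v by rewrite -val_eqE /= ltn_eqF.
  split; rewrite (mem_edges _ _ pP).
    by rewrite (_ : upper u != upper v) //; apply: contraNneq uv' => -[->].
  rewrite (_ : lower u != lower v); last by apply: contraNneq uv' => -[->].
  rewrite (symmetric_lower (upper u) pP sym).
  by rewrite -(inj_eq (can_inj (@flipK n)) (partner p (upper u))).
have lsing i : ([set lower i] \in p) = ([set upper i] \in p).
  rewrite !mem_singleton // (symmetric_lower (upper i) pP sym).
  by rewrite -[RHS](inj_eq (can_inj (@flipK n))).
apply: (iffP forallP) => [H i ii|H i].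
  have /andP[/implyP + _] := H i; rewrite mem_singleton // ii eqxx => /(_ isT).
  rewrite sing => [/existsP[u /existsP[v /andP[uv uiv]]]|x y []//].
  have uv' : u < v by case/andP: uiv => ui /(ltn_trans ui).
  by exists u, v; move: uv; rewrite (edgeE _ _ uv').1 => /eqP.
have nestedE : partner p (upper i) = upper i -> exists u v : 'I_n, u < v /\ u < i < v /\ partner p (upper u) = upper v.
  case/H=> u [v [uv uiv]]; exists u, v; split=> //.
  by case/andP: uiv => ui /(ltn_trans ui).
rewrite lsing mem_singleton // !sing; try by move=> x y [].
by apply/andP; split; apply/implyP=> /eqP/nestedE[u [v [uv [uiv e]]]];
  apply/existsP; exists u; apply/existsP; exists v;
  rewrite ?(edgeE _ _ uv).1 ?(edgeE _ _ uv).2 e eqxx uiv.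
Qed.

(** * The generators and their necessity *)

Definition tight_projections (d : nat) : {set diagram n} :=
  [set p in projections n d | no_unnested_singletons p].

Lemma num_projectionsE (R : realType) (d : nat) :
  num_projections R n d = #|tight_projections d|.
Proof.
rewrite /num_projections /motzkin_D motzkinE; apply: eq_card => p.
apply/setIdP/setIdP => [[/setIdP[pN rk] /andP[pr nus]]|[/setIdP[pN /andP[sym rk]] nus]].
  by split=> //; apply/setIdP; rewrite pN rk -projectionE // pr.
by split; [apply/setIdP; rewrite pN rk|rewrite projectionE // sym].
Qed.

Definition E_generators : {set diagram n} :=
  projections n r :|: tight_projections r.-1.

Lemma card_E_generators : 0 < r ->
  #|E_generators| = #|projections n r| + #|tight_projections r.-1|.
Proof.
move=> r0; rewrite /E_generators cardsU.
suff -> : projections n r :&: tight_projections r.-1 = set0 by rewrite cards0 subn0.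
apply/setP=> p; rewrite in_set0; apply/negP=> /setIP[/projectionsP[_ _ rp]].
by case/setIdP=> /projectionsP[_ _]; rewrite rp; lia.
Qed.

Lemma E_generators_sub : E_generators \subset E_set.
Proof.
rewrite subUset projections_E_set //=; apply: subset_trans (projections_E_set (leq_pred r)).
by apply/subsetP=> p /setIdP[].
Qed.

(* If [y] has rank [r] and [y z] has rank [r - 1] then the transversal of [y] lost in
   [y z] leaves a singleton, which is not nested. *)
Lemma E_generators_prime p y z : p \in E_generators -> y \in E_set -> z \in E_set ->
  hooks (@upper n) (dmul y z) = hooks (@upper n) p ->
  hooks (@upper n) y = hooks (@upper n) p.
Proof.
move=> pG /E_setP[yN ry _] /E_setP[zN _ _] e.
have yP := nc_pb yN; have zP := nc_pb zN; have yzP := dmul_pb yP zP.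
have pN : p \in nc_monoid n by case/setUP: pG => [/projectionsP[]|/setIdP[/projectionsP[]]].
have ed := eq_dom yzP (nc_pb pN) e.
have enough : #|ddom y| <= #|ddom p| -> hooks (@upper n) y = hooks (@upper n) p.
  by rewrite -e -ed; apply: (eq_hooks yP yzP (hooks_dmul yP zP)).
case/setUP: pG => [/projectionsP[_ _ rp]|/setIdP[/projectionsP[_ sym rp] nus]].
  by apply: enough; rewrite rp.
apply: enough; rewrite leqNgt; apply/negP=> lt.
have sub := dom_dmul yP zP.
have /cards1P[i ei] : #|ddom y :\: ddom (dmul y z)| == 1.
  by rewrite cardsDS // ed rp eqn_leq subn_gt0 -rp lt andbT rp leq_subLR; lia.
have /setDP[iy iyz] : i \in ddom y :\: ddom (dmul y z) by rewrite ei set11.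
have keep j : j \notin ddom (dmul y z) -> j != i -> j \notin ddom y.
  move=> jyz ji; apply: contra ji => jy; rewrite -in_set1 -ei; exact/setDP.
have [l il] := not_ddomP _ yzP iyz.
have li : l = i.
  apply/eqP; apply: contraT => li; have ly : l \notin ddom y.
    apply: keep li; apply/(not_ddomP _ yzP); exists i; exact: partner_swap.
  have [m lm] := not_ddomP _ yP ly.
  have := dmul_upper yP zP lm; rewrite (partner_swap yzP il) => -[im].
  have : i \notin ddom y.
    by apply/(not_ddomP _ yP); exists l; apply: partner_swap; rewrite // im.
  by rewrite iy.
have ip : partner p (upper i) = upper i.
  by apply/upper_hooksP; rewrite -e; apply/upper_hooksP; rewrite il li.
have [u [v [/upper_hooksP uv uiv]]] := no_unnestedP pN sym nus i ip.
have ui : u != i by case/andP: uiv => ui _; rewrite -val_eqE /= ltn_eqF.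
rewrite -e in uv; have uv' := upper_hooksP _ _ _ uv.
have uy : u \notin ddom y by apply: keep ui; apply/(not_ddomP _ yzP); exists v.
have [v' uy'] := not_ddomP _ yP uy.
have := dmul_upper yP zP uy'; rewrite uv' => -[vv'].
rewrite -vv' in uy'; have [k ik _] := upper_hook_inside yN uy' uiv.
by move: iy; rewrite mem_ddom // ik.
Qed.

(** By primality every generator [p] has an element of [A] in its R-class, and [proj] maps that
    element to [p]. So [proj] carries [A] onto a superset of the generators. *)
Lemma leq_card_E_generators (A : {set diagram n}) :
  generated (@dmul n) A = E_set -> #|E_generators| <= #|A|.
Proof.
move=> gA; apply: leq_trans (leq_imset_card (@proj n) A).
apply/subset_leq_card/subsetP=> p pG.
have pN : p \in nc_monoid n by case/E_setP: (subsetP E_generators_sub _ pG).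
have sym : dstar p = p by case/setUP: pG => [/projectionsP[]|/setIdP[/projectionsP[]]].
pose P y := hooks (@upper n) y == hooks (@upper n) p.
have prime : {in E_set &, forall y z, P (dmul y z) -> P y}.
  by move=> y z yE zE /eqP e; apply/eqP; apply: E_generators_prime pG yE zE e.
have [y yA /eqP yp] := mem_generated_sub gA (subsetP E_generators_sub _ pG) E_set_closed
  (P := P) (eqxx _) prime.
have yN : y \in nc_monoid n.
  have : y \in E_set by rewrite -gA; apply: subsetP (sub_generated _ A) _ yA.
  by case/E_setP.
apply/imsetP; exists y => //; symmetry; apply: symmetric_eq => //.
- exact: proj_nc.
- exact: proj_star (nc_pb yN).
- by rewrite hooks_proj // nc_pb.
Qed.

End IdealE.

(** * Linking domains of equal rank *)

(* A word encodes the set of the positions of its letters [true]; a step moves such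
   a letter over two or more letters [false]. *)
Inductive slide : seq bool -> seq bool -> Prop :=
| slide_refl w : slide w w
| slide_sym w1 w2 : slide w1 w2 -> slide w2 w1
| slide_trans w1 w2 w3 : slide w1 w2 -> slide w2 w3 -> slide w1 w3
| slide_step u v m : 1 < m ->
    slide (u ++ nseq m false ++ true :: v) (u ++ true :: nseq m false ++ v).

Lemma slide_invariant w1 w2 : slide w1 w2 ->
  size w1 = size w2 /\ count id w1 = count id w2.
Proof.
elim=> [w|w3 w4 _ [-> ->]|w3 w4 w5 _ [-> ->]|u v m _] //.
by rewrite !size_cat !count_cat /= !size_cat !count_cat /= size_nseq; split; lia.
Qed.

(** A pair of zeros passes a letter [true] by one step, and a letter [false] without any change of
    the word. *)
Lemma slide_pair v u t :
  slide (u ++ [:: false, false & v ++ t]) (u ++ v ++ [:: false, false & t]).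
Proof.
elim: v u => [|[] v IH] u; first exact: slide_refl.
  apply: slide_trans (slide_step u (v ++ t) (ltnSn 1)) _.
  by have := IH (rcons u true); rewrite !cat_rcons.
by have := IH (rcons u false); rewrite !cat_rcons.
Qed.

(** A lone zero cannot pass a [true]. The pair is fetched next to it, one [true] crosses the
    resulting three zeros, and the pair is sent back. *)
Lemma slide_ones a u t : slide (u ++ false :: nseq a true ++ [:: false, false & t])
  (u ++ nseq a true ++ [:: false, false, false & t]).
Proof.
elim: a u => [|a IH] u; first exact: slide_refl.
apply: (@slide_trans _ (u ++ [:: false, false, false, true & nseq a true ++ t])).
  apply: slide_sym; have := slide_pair (nseq a.+1 true) (rcons u false) t.
  by rewrite !cat_rcons.
apply: slide_trans (slide_step u (nseq a true ++ t) (isT : 1 < 3)) _.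
have := slide_pair (nseq a true) (u ++ [:: true; false]) t.
rewrite -!catA /= => H; apply: slide_trans H _.
by have := IH (rcons u true); rewrite !cat_rcons.
Qed.

Lemma slide_sort w u t :
  slide (u ++ w ++ [:: false, false & t])
        (u ++ nseq (count id w) true ++ nseq (size w - count id w) false ++
           [:: false, false & t]).
Proof.
elim: w u => [|[] w IH] u; first exact: slide_refl.
  by have := IH (rcons u true); rewrite !cat_rcons /= add1n subSS.
have := IH (rcons u false); rewrite !cat_rcons /= add0n => H; apply: slide_trans H _.
rewrite subSn ?count_size //; set a := count id w; set b := size w - a.
have comm m (v : seq bool) : nseq m false ++ false :: v = false :: nseq m false ++ v.
  by elim: m => //= m ->.
rewrite !comm; exact: (slide_ones a u (nseq b false ++ t)).
Qed.

(** The pair is parked at the right end and then serves to sort all other letters. *)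
Lemma slide_canonical w1 w2 :
  slide (w1 ++ [:: false, false & w2])
        (nseq (count id (w1 ++ w2)) true ++
         nseq (size (w1 ++ w2) - count id (w1 ++ w2)) false ++ [:: false; false]).
Proof.
have := slide_pair w2 w1 [::]; rewrite cats0 => H; apply: slide_trans H _.
by have := slide_sort (w1 ++ w2) [::] [::]; rewrite -!catA.
Qed.

Lemma nth_nseq_false m (v : seq bool) k :
  nth false (nseq m false ++ v) k = (m <= k) && nth false v (k - m).
Proof. by rewrite nth_cat size_nseq nth_nseq; case: ltnP => // _; case: ifP. Qed.

(** * Slides of domains realised by products *)

Section Connect.

Variables (n : nat) (B : {set diagram n}) (d : nat).
Hypotheses (B_closed : mul_closed (@dmul n) B) (B_proj : projections n d \subset B).
Implicit Types (a b c p q g : diagram n) (i j k l m x y z : 'I_n) (A D : {set 'I_n}).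

(** Symmetry is not automatic, as [B] is not assumed closed under [dstar]; links are therefore built
    in both directions. *)
Definition linked D1 D2 :=
  exists g, [/\ g \in B, g \in nc_monoid n, ddom g = D1 & dcodom g = D2].

Lemma linked_trans D1 D2 D3 : linked D1 D2 -> linked D2 D3 -> linked D1 D3.
Proof.
case=> g [gB gN dg cg] [h [hB hN dh ch]]; exists (dmul g h).
have [-> ->] := dom_dmul_codom (nc_pb gN) (nc_pb hN) (etrans cg (esym dh)).
by split=> //; [exact: (mul_closedP _ _ B_closed)|exact: nc_dmul].
Qed.

Lemma linked_refl D : #|D| = d -> linked D D.
Proof.
move=> rk; exists (partial_id D); rewrite partial_id_dom partial_id_codom.
split=> //; last exact: partial_id_nc.
apply: (subsetP B_proj); apply/projectionsP; rewrite partial_id_dom partial_id_star.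
by split=> //; exact: partial_id_nc.
Qed.

Definition hook_pattern D x y : diagram n := pattern (tperm x y) D.

Section HookPattern.

Variables (D : {set 'I_n}) (x y : 'I_n).
Hypotheses (xy : x < y) (Dxy : forall k, x <= k <= y -> k \notin D).

Let sD : {in D, forall i, tperm x y i = i}.
Proof.
move=> i iD; apply: tpermD; apply: contraTneq iD => <-; apply: Dxy;
  by rewrite leqnn ltnW.
Qed.

Let nested_xy i k : i < k < tperm x y i -> (k \notin D) && (i < tperm x y k < tperm x y i).
Proof.
case: tpermP => [->|->|_ _]; last by case/andP=> ik /(ltn_trans ik); rewrite ltnn.
  case/andP=> xk ky; rewrite Dxy ?(ltnW xk) ?(ltnW ky) //.
  by rewrite tpermD ?xk // -val_eqE /= ?(ltn_eqF xk) ?(gtn_eqF ky).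
by case/andP=> yk kx; have := ltn_trans (ltn_trans xy yk) kx; rewrite ltnn.
Qed.

Lemma hook_pattern_nc : hook_pattern D x y \in nc_monoid n.
Proof. exact: pattern_nc (tpermK x y) sD nested_xy. Qed.

Lemma hook_pattern_star : dstar (hook_pattern D x y) = hook_pattern D x y.
Proof. exact: pattern_star (tpermK x y) sD. Qed.

Lemma hook_pattern_dom : ddom (hook_pattern D x y) = D.
Proof. exact: pattern_dom (tpermK x y) sD. Qed.

Lemma hook_pattern_upper i : partner (hook_pattern D x y) (upper i) =
  if i \in D then lower i else upper (tperm x y i).
Proof. exact: (partner_pattern (tpermK x y) sD). Qed.

Lemma hook_pattern_projections : #|D| = d -> hook_pattern D x y \in projections n d.
Proof.
move=> rk; apply/projectionsP; split.
- exact: hook_pattern_nc.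
- exact: hook_pattern_star.
- by rewrite hook_pattern_dom.
Qed.

End HookPattern.

(** The transversal of [p] at [z] continues along the hook of [z] and [y] in [q], back along the
    lower hook of [y] and [x] in [p], and leaves through the transversal of [q] at [x]. *)
Lemma linked_zigzag p q D x y z : p \in projections n d -> q \in projections n d ->
  ddom p = z |: D -> ddom q = x |: D -> x \notin D -> z \notin D ->
  partner q (upper z) = upper y -> partner p (upper y) = upper x ->
  linked (z |: D) (x |: D).
Proof.
move=> pJ qJ dp dq xD zD qzy pyx.
have /projectionsP[pN sp _] := pJ; have /projectionsP[qN sq _] := qJ.
have pP := nc_pb pN; have qP := nc_pb qN; have pqP := dmul_pb pP qP.
have pzz : partner p (upper z) = lower z.
  by apply: symmetric_straight; rewrite ?dp ?setU11.
have qxx : partner q (upper x) = lower x.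
  by apply: symmetric_straight; rewrite ?dq ?setU11.
have pyx' : partner p (lower y) = lower x.
  by rewrite (symmetric_lower (upper y) pP sp) pyx.
have dpq : ddom (dmul p q) = z |: D.
  apply/eqP; rewrite eqEsubset -{1}dp dom_dmul //=; apply/subsetP=> i /setU1P[->|iD].
    by apply/(ddomP _ pqP); exists x; apply: (dmul_zigzag pP qP pzz qzy pyx' qxx).
  apply/(ddomP _ pqP); exists i; apply: (dmul_transversal pP qP (j := i)).
    by apply: symmetric_straight; rewrite // dp setU1r.
  by apply: symmetric_straight; rewrite // dq setU1r.
exists (dmul p q); split=> //.
- by apply: (mul_closedP _ _ B_closed); apply: (subsetP B_proj).
- exact: nc_dmul.
apply/eqP; rewrite eqEcard -{1}dq -(symmetric_codom qP sq) codom_dmul //=.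
by rewrite -card_dom_codom // dpq !cardsU1 xD zD.
Qed.

Lemma linked_jump D x y z : x < y < z -> (forall k, x <= k <= z -> k \notin D) ->
  #|D|.+1 = d -> linked (z |: D) (x |: D) /\ linked (x |: D) (z |: D).
Proof.
case/andP=> xy yz Dxz rk.
have xz : x < z := ltn_trans xy yz.
have xD : x \notin D by rewrite Dxz // leqnn ltnW.
have zD : z \notin D by rewrite Dxz // leqnn ltnW.
have yD : y \notin D by rewrite Dxz // (ltnW xy) (ltnW yz).
have nxy : x != y by rewrite -val_eqE /= ltn_eqF.
have nyz : y != z by rewrite -val_eqE /= ltn_eqF.
have nxz : x != z by rewrite -val_eqE /= ltn_eqF.
have Dp k : x <= k <= y -> k \notin z |: D.
  case/andP=> xk ky; rewrite !inE negb_or (Dxz k) ?xk ?(leq_trans ky (ltnW yz)) // andbT.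
  by rewrite -val_eqE /= ltn_eqF // (leq_ltn_trans ky yz).
have Dq k : y <= k <= z -> k \notin x |: D.
  case/andP=> yk kz; rewrite !inE negb_or (Dxz k) ?kz ?(leq_trans (ltnW xy) yk) // andbT.
  by rewrite -val_eqE /= gtn_eqF // (leq_trans xy yk).
have pJ : hook_pattern (z |: D) x y \in projections n d.
  by apply: hook_pattern_projections => //; rewrite cardsU1 zD.
have qJ : hook_pattern (x |: D) y z \in projections n d.
  by apply: hook_pattern_projections => //; rewrite cardsU1 xD.
have pU := hook_pattern_upper xy Dp; have qU := hook_pattern_upper yz Dq.
have dp := hook_pattern_dom xy Dp; have dq := hook_pattern_dom yz Dq.
split.
  apply: (linked_zigzag (y := y) pJ qJ dp dq xD zD).
    by rewrite qU !inE eq_sym (negPf nxz) (negPf zD) tpermR.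
  by rewrite pU !inE (negPf nyz) (negPf yD) tpermR.
apply: (linked_zigzag (y := y) qJ pJ dq dp zD xD).
  by rewrite pU !inE (negPf nxz) (negPf xD) tpermL.
by rewrite qU !inE eq_sym (negPf nxy) (negPf yD) tpermL.
Qed.

Definition word_set (w : seq bool) : {set 'I_n} := [set i : 'I_n | nth false w i].

Lemma card_word_set w : size w = n -> #|word_set w| = count id w.
Proof.
move=> sw; rewrite -sum1_card -sum1_count (big_nth false) big_mkord sw.
by apply: eq_bigl => i; rewrite inE.
Qed.

Lemma slide_linked w1 w2 : slide w1 w2 -> size w1 = n -> count id w1 = d ->
  linked (word_set w1) (word_set w2) /\ linked (word_set w2) (word_set w1).
Proof.
elim=> [w|w3 w4 s34 IH|w3 w4 w5 s34 IH34 s45 IH45|u v m m1] sw cw.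
- by split; apply: linked_refl; rewrite card_word_set.
- by have [e1 e2] := slide_invariant s34; case: IH => //; rewrite ?e1 ?e2.
- have [e1 e2] := slide_invariant s34; rewrite e1 in sw IH34; rewrite e2 in cw IH34.
  have [l34 l43] := IH34 sw cw; have [l45 l54] := IH45 sw cw.
  by split; apply: linked_trans; eassumption.
(* The letter moves between the columns [size u] and [size u + m]; since [1 < m], the column
   [size u + 1] lies strictly between them and serves as the middle one. *)
have uz : size u + m < n by move: sw; rewrite !size_cat size_nseq /=; lia.
have uy : (size u).+1 < n by lia.
have ux : size u < n by lia.
pose D := word_set (u ++ nseq m.+1 false ++ v).
have e1 : word_set (u ++ nseq m false ++ true :: v) = Ordinal uz |: D.
  apply/setP=> i; rewrite in_setU1 !in_set -val_eqE /= !(nth_cat _ u).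
  case: (ltnP i (size u)) => iu; first by rewrite ltn_eqF // (leq_trans iu) // leq_addr.
  rewrite -[false :: _]/(nseq m.+1 false ++ v) !nth_nseq_false.
  have -> : (i == size u + m :> nat) = (i - size u == m) by lia.
  case: (ltngtP m (i - size u)) => [lt|gt|<-] //=; last by rewrite subnn.
  by rewrite -[X in nth _ _ X](subnSK lt).
have e2 : word_set (u ++ true :: nseq m false ++ v) = Ordinal ux |: D.
  apply/setP=> i; rewrite in_setU1 !in_set -val_eqE /= !(nth_cat _ u).
  case: (ltnP i (size u)) => iu; first by rewrite ltn_eqF.
  rewrite -[false :: _]/(nseq m.+1 false ++ v) nth_nseq_false.
  have -> : (i == size u :> nat) = (i - size u == 0) by lia.
  by case: (i - size u) => //= k; rewrite nth_nseq_false.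
rewrite e1 e2; apply: (@linked_jump _ _ (Ordinal uy)).
- by rewrite /=; lia.
- move=> k /= /andP[uk km]; rewrite in_set nth_cat ltnNge uk /=.
  by rewrite -[false :: _]/(nseq m.+1 false ++ v) nth_nseq_false ltn_subRL ltnNge km.
have sD : size (u ++ nseq m.+1 false ++ v) = n.
  by rewrite -sw !size_cat /= !size_nseq; lia.
by move: cw; rewrite /D (card_word_set sD) !count_cat /=; lia.
Qed.

Lemma set_word D : exists2 w, size w = n & word_set w = D.
Proof.
exists [seq i \in D | i <- enum 'I_n]; first by rewrite size_map size_enum_ord.
by apply/setP=> i; rewrite inE (nth_map i) ?size_enum_ord // nth_ord_enum.
Qed.

Lemma linked_noncosparse D1 D2 : #|D1| = d -> #|D2| = d ->
  ~~ cosparse D1 -> ~~ cosparse D2 -> linked D1 D2.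
Proof.
pose can := nseq d true ++ nseq (n - 2 - d) false ++ [:: false; false].
have canonical D : #|D| = d -> ~~ cosparse D ->
    linked D (word_set can) /\ linked (word_set can) D.
  have [w sw <-] := set_word D; rewrite card_word_set // => cw.
  case/not_cosparseP=> i [j [ij iw jw]]; rewrite !inE in iw jw.
  have ew : w = take i w ++ [:: false, false & drop i.+2 w].
    rewrite -{1}(cat_take_drop i w) (drop_nth false) ?sw // (negPf iw).
    by rewrite (drop_nth false) -?ij ?sw // (negPf jw).
  have := slide_canonical (take i w) (drop i.+2 w); rewrite -ew.
  have -> : count id (take i w ++ drop i.+2 w) = d.
    by rewrite -cw [in RHS]ew !count_cat /= !add0n.
  have -> : size (take i w ++ drop i.+2 w) = n - 2.
    by move: (congr1 size ew); rewrite sw !size_cat /=; lia.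
  by move/slide_linked; apply.
move=> r1 r2 /(canonical _ r1)[l1 _] /(canonical _ r2)[_ l2].
exact: linked_trans l1 l2.
Qed.

(** With any [g] linking the domain to the codomain, [a] is [proj a] times [g] times
    [proj (dstar a)]: the outer factors supply the upper and lower blocks, and equal rank excludes
    further ones. *)
Lemma noncosparse_mem a : a \in nc_monoid n -> #|ddom a| = d ->
  ~~ cosparse (ddom a) -> ~~ cosparse (dcodom a) -> a \in B.
Proof.
move=> aN rk nd nc; have aP := nc_pb aN; have sN := nc_star aN.
have rk' : #|dcodom a| = d by rewrite -card_dom_codom.
have [g [gB gN dg cg]] := linked_noncosparse rk rk' nd nc.
have gP := nc_pb gN.
have pN := proj_nc aN; have pP := nc_pb pN; have qN := proj_nc sN; have qP := nc_pb qN.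
have dq : ddom (proj (dstar a)) = dcodom a by rewrite dom_proj ?star_pb // dom_star.
have cp : dcodom (proj a) = ddom a.
  by rewrite (symmetric_codom pP (proj_star aP)) dom_proj.
have [d1 c1] := dom_dmul_codom pP gP (etrans cp (esym dg)).
have pgP := dmul_pb pP gP.
have [d2 c2] := dom_dmul_codom pgP qP (etrans c1 (etrans cg (esym dq))).
have -> : a = dmul (dmul (proj a) g) (proj (dstar a)).
  apply: (eq_nc aN); first exact: nc_dmul (nc_dmul pN gN) qN.
    apply: (eq_hooks aP (dmul_pb pgP qP)); last by rewrite d2 d1 dom_proj.
    rewrite -(hooks_proj aP).
    exact: subset_trans (hooks_dmul pP gP) (hooks_dmul pgP qP).
  rewrite -(hooks_star aP) -(hooks_star (dmul_pb pgP qP)).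
  apply: (eq_hooks (star_pb aP) (star_pb (dmul_pb pgP qP))).
    rewrite (hooks_star (dmul_pb pgP qP)) -(hooks_proj (star_pb aP)).
    rewrite -(symmetric_hooks qP (proj_star (star_pb aP))).
    exact: (lower_hooks_dmul pgP qP).
  rewrite (dom_star aP) (dom_star (dmul_pb pgP qP)) c2 (symmetric_codom qP (proj_star (star_pb aP))) dq.
  exact: leqnn.
have mem b : b \in nc_monoid n -> #|ddom b| = d -> proj b \in B.
  by move=> bN rb; apply: (subsetP B_proj); rewrite -rb; apply: proj_projections.
apply: (mul_closedP _ _ B_closed); last by apply: mem; rewrite ?dom_star.
by apply: (mul_closedP _ _ B_closed); rewrite ?mem.
Qed.

End Connect.

(** * Opening blocks *)

Section Open.

Variable n : nat.
Implicit Types (a b c p q : diagram n) (i j k l m u v x y : 'I_n) (A D : {set 'I_n}).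

(** On a projection this is an involution of the columns that fixes the domain, because transversals
    are vertical. *)
Definition mate p i : 'I_n := column (partner p (upper i)).

Definition unnested p x := forall u v, partner p (upper u) = upper v -> ~~ (u < x < v).

Lemma mate_upper p i : p \in partial_brauer n -> i \notin ddom p ->
  partner p (upper i) = upper (mate p i).
Proof. by move=> pP /(not_ddomP _ pP)[j ij]; rewrite /mate ij. Qed.

Lemma mate_dom p i : p \in nc_monoid n -> dstar p = p -> i \in ddom p -> mate p i = i.
Proof. by move=> pN sym iD; rewrite /mate (symmetric_straight pN sym iD). Qed.

Lemma mate_notin p i : p \in partial_brauer n -> i \notin ddom p -> mate p i \notin ddom p.
Proof.
move=> pP iD; apply/(not_ddomP _ pP); exists i; apply: partner_swap => //.
exact: mate_upper.
Qed.

Lemma mateK p : p \in nc_monoid n -> dstar p = p -> involutive (mate p).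
Proof.
move=> pN sym i; have pP := nc_pb pN; case: (boolP (i \in ddom p)) => iD.
  by rewrite !mate_dom.
by rewrite {1}/mate (partner_swap pP (mate_upper pP iD)).
Qed.

(** If a hook covers [x0], the left end of the hook that starts furthest left is unnested. The last
    clause later keeps [x] apart from a given singleton. *)
Lemma exists_unnested p x0 : p \in partial_brauer n -> x0 \notin ddom p ->
  exists2 x, x \notin ddom p & unnested p x /\ (x = x0 \/ partner p (upper x) != upper x).
Proof.
move=> pP x0D; case: (pickP [pred h : 'I_n * 'I_n |
    (partner p (upper h.1) == upper h.2) && (h.1 < x0 < h.2)]) => [h0 h0P|none].
  have h0Q : (partner p (upper h0.1) == upper h0.2) && (h0.1 < h0.2).
    by case/andP: h0P => -> /andP[] /ltn_trans; apply.
  case: (@arg_minnP _ h0 (fun h : 'I_n * 'I_n =>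
    (partner p (upper h.1) == upper h.2) && (h.1 < h.2)) (fun h => h.1) h0Q).
  move=> [u v] /= /andP[/eqP uv ltuv] min; exists u.
    by apply/(not_ddomP _ pP); exists v.
  split; last by right; rewrite uv; apply/eqP=> -[e]; rewrite e ltnn in ltuv.
  move=> u' v' uv'; apply/negP=> /andP[u'u uv2].
  have := min (u', v'); rewrite /= uv' eqxx (ltn_trans u'u uv2) => /(_ isT).
  by rewrite leqNgt u'u.
exists x0 => //; split; last by left.
move=> u v uv; have := none (u, v); rewrite /= uv eqxx /=.
by move=> ->.
Qed.

Section Fixed.

Variables (p : diagram n) (x : 'I_n).
Hypotheses (pN : p \in nc_monoid n) (sym : dstar p = p).
Hypotheses (xD : x \notin ddom p) (xU : unnested p x).

Let pP := nc_pb pN.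

Definition open_mate i := if (i == x) || (i == mate p x) then i else mate p i.

(* The block of [x] is replaced by the transversal [{x, x'}]; its other element, if
   any, becomes a singleton. *)
Definition open_at : diagram n := pattern open_mate (x |: ddom p).

Let open_mateK : involutive open_mate.
Proof.
move=> i; rewrite {2}/open_mate; case: ifP => [ix|ix]; rewrite /open_mate ?ix //.
have mate_inj := can_inj (mateK pN sym).
rewrite (inj_eq mate_inj) -[mate p i == x](inj_eq mate_inj) !(mateK pN sym) orbC ix.
by [].
Qed.

Let open_mateD : {in x |: ddom p, forall i, open_mate i = i}.
Proof.
move=> i /setU1P[->|iD]; rewrite /open_mate ?eqxx //.
by case: ifP => // _; rewrite mate_dom.
Qed.

Let open_nested i k : i < k < open_mate i ->
  (k \notin x |: ddom p) && (i < open_mate k < open_mate i).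
Proof.
case/andP=> ik ki; have iE : open_mate i = mate p i.
  by move: ki; rewrite /open_mate; case: ifP => // _ /(ltn_trans ik); rewrite ltnn.
rewrite iE in ki *; have iD : i \notin ddom p.
  by apply: contraTN ki => iD; rewrite mate_dom // -leqNgt ltnW.
have ikm : i < k < mate p i by rewrite ik.
have [l kl il] := upper_hook_inside pN (mate_upper pP iD) ikm.
have kx : k != x by apply: contraTneq ikm => ->; apply: xU (mate_upper pP iD).
have kD : k \notin ddom p by apply/(not_ddomP _ pP); exists l.
rewrite in_setU1 (negPf kx) kD /open_mate (negPf kx) /=.
by case: ifP => // _; rewrite /mate kl.
Qed.

Lemma open_nc : open_at \in nc_monoid n.
Proof. exact: (pattern_nc open_mateK open_mateD open_nested). Qed.

Lemma open_star : dstar open_at = open_at.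
Proof. exact: (pattern_star open_mateK open_mateD). Qed.

Lemma open_dom : ddom open_at = x |: ddom p.
Proof. exact: (pattern_dom open_mateK open_mateD). Qed.

Lemma open_upper i : partner open_at (upper i) =
  if i \in x |: ddom p then lower i else upper (open_mate i).
Proof. exact: (partner_pattern open_mateK open_mateD). Qed.

Lemma open_projections : open_at \in projections n #|ddom p|.+1.
Proof.
apply/projectionsP; rewrite open_star open_dom cardsU1 xD.
by split=> //; exact: open_nc.
Qed.

Lemma open_keep i : i \notin ddom p -> i != x -> i != mate p x ->
  partner open_at (upper i) = partner p (upper i).
Proof.
move=> iD ix iy; rewrite open_upper in_setU1 (negPf ix) (negPf iD) /=.
by rewrite /open_mate (negPf ix) (negPf iy) mate_upper.
Qed.

Lemma open_singleton i : i != x -> i = mate p x \/ partner p (upper i) = upper i ->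
  partner open_at (upper i) = upper i.
Proof.
move=> ix [e|e]; rewrite open_upper in_setU1 (negPf ix) /=.
  by rewrite e (negPf (mate_notin pP xD)) /open_mate eqxx orbT.
have -> : (i \in ddom p) = false by apply/negbTE/(not_ddomP _ pP); exists i.
by rewrite /open_mate; case: ifP => // _; rewrite /mate e.
Qed.

Lemma open_hook u v : partner open_at (upper u) = upper v -> u != v ->
  partner p (upper u) = upper v.
Proof.
rewrite open_upper in_setU1; case: ifP => // /negbT; rewrite negb_or => /andP[_ uD].
by case; rewrite /open_mate; case: ifP => [_ ->|_ <- _]; rewrite ?eqxx // mate_upper.
Qed.

End Fixed.

Lemma eq_nc_sub a b : a \in nc_monoid n -> b \in nc_monoid n ->
  hooks (@upper n) a \subset hooks (@upper n) b ->
  hooks (@lower n) a \subset hooks (@lower n) b -> #|ddom a| <= #|ddom b| -> a = b.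
Proof.
move=> aN bN su sl le; have aP := nc_pb aN; have bP := nc_pb bN.
apply: eq_nc => //; first exact: eq_hooks.
rewrite -(hooks_star aP) -(hooks_star bP); apply: eq_hooks; rewrite ?star_pb //.
  by rewrite (hooks_star aP) (hooks_star bP).
by rewrite (dom_star aP) (dom_star bP) -(card_dom_codom aP) -(card_dom_codom bP).
Qed.

(** The transversal at [i] of the outer factors dies at the singleton [i] of the middle one, while
    the outer factors retain the block of [x]. So all blocks of [p] in both rows are present, and
    its transversals survive. *)
Lemma symmetric_split p i x : p \in nc_monoid n -> dstar p = p ->
  partner p (upper i) = upper i -> unnested p i -> x \notin ddom p -> unnested p x ->
  i != x ->
  p = dmul (dmul (open_at p i) (open_at p x)) (open_at p i).
Proof.
move=> pN sym ii iU xD xU ix; have pP := nc_pb pN.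
have iD : i \notin ddom p by apply/(not_ddomP _ pP); exists i.
have PN := open_nc pN sym iU; have QN := open_nc pN sym xU.
have PP := nc_pb PN; have QP := nc_pb QN; have PQP := dmul_pb PP QP.
have symP := open_star i pN sym; have symQ := open_star x pN sym.
have Pi : partner (open_at p i) (upper i) = lower i.
  by rewrite open_upper // setU11.
have Pi' : partner (open_at p i) (lower i) = upper i by apply: partner_swap.
have Qi : partner (open_at p x) (upper i) = upper i by apply: open_singleton => //; right.
have Qi' : partner (open_at p x) (lower i) = lower i.
  by rewrite (symmetric_lower (upper i) QP symQ) Qi.
have mi : mate p i = i by rewrite /mate ii.
have Pj j : j \notin ddom p -> j != i -> partner (open_at p i) (upper j) = partner p (upper j).
  by move=> jD ji; apply: open_keep; rewrite // mi.
have straight j : j \in ddom p ->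
    partner (open_at p i) (upper j) = lower j /\ partner (open_at p x) (upper j) = lower j.
  by move=> jD; rewrite !open_upper // !setU1r.
apply: (eq_nc_sub pN); first exact: nc_dmul (nc_dmul PN QN) PN.
- apply/subsetP=> -[j k] /upper_hooksP jk; apply/upper_hooksP.
  case: (eqVneq j i) => [ji|ji].
    move: jk; rewrite ji ii => -[<-]; apply: (dmul_upper PQP PP).
    exact: (dmul_hook PP QP Pi Qi Pi').
  apply: (dmul_upper PQP PP); apply: (dmul_upper PP QP); rewrite Pj //.
  by apply/(not_ddomP _ pP); exists k.
- rewrite (symmetric_hooks pP sym); apply/subsetP=> -[j k] /upper_hooksP jk; apply/lower_hooksP.
  case: (eqVneq j i) => [ji|ji].
    move: jk; rewrite ji ii => -[<-].
    exact: (dmul_lower_hook PQP PP Pi' (dmul_lower PP QP Qi') Pi).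
  apply: (dmul_lower PQP PP); rewrite (symmetric_lower (upper j) PP symP) Pj ?jk //.
  by apply/(not_ddomP _ pP); exists k.
apply/subset_leq_card/subsetP=> j jD; have [Ps Qs] := straight j jD.
apply/(ddomP _ (dmul_pb PQP PP)); exists j.
exact: (dmul_transversal PQP PP (dmul_transversal PP QP Ps Qs) Ps).
Qed.

End Open.

(** * Generation *)

Section Generation.

Variables (n : nat) (B : {set diagram n}).
Hypothesis B_closed : mul_closed (@dmul n) B.
Implicit Types (a b c p q : diagram n) (i j k l m u v x y : 'I_n) (A D : {set 'I_n}).

Let B_mul a b : a \in B -> b \in B -> dmul a b \in B.
Proof. exact: (mul_closedP _ _ B_closed). Qed.

(** The bound provides a free column besides [i], hence a second unnested place to open; both opened
    projections have rank [d + 1]. *)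
Lemma loose_projection_mem (d : nat) p i : projections n d.+1 \subset B -> d + 2 <= n ->
  p \in projections n d -> partner p (upper i) = upper i -> unnested p i -> p \in B.
Proof.
move=> subB dn /projectionsP[pN sym rk] ii iU; have pP := nc_pb pN.
have iD : i \notin ddom p by apply/(not_ddomP _ pP); exists i.
have [x0 x0D] : exists x0, x0 \notin i |: ddom p.
  apply/existsP; rewrite -negb_forall; apply/negP=> /forallP all_in.
  have : #|'I_n| <= #|i |: ddom p| by apply/subset_leq_card/subsetP=> j _; apply: all_in.
  by rewrite card_ord cardsU1 iD rk; lia.
rewrite in_setU1 negb_or in x0D; case/andP: x0D => x0i x0D.
have [x xD [xU xx]] := exists_unnested pP x0D.
have ix : i != x.
  by case: xx => [->|]; rewrite 1?eq_sym //; apply: contraNneq => <-; rewrite ii.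
rewrite (symmetric_split pN sym ii iU xD xU ix).
have iB : open_at p i \in B.
  by apply: (subsetP subB); rewrite -rk; apply: open_projections.
have xB : open_at p x \in B.
  by apply: (subsetP subB); rewrite -rk; apply: open_projections.
by apply: B_mul => //; apply: B_mul.
Qed.

Lemma set_subset_card A : #|A| + 2 <= n ->
  exists i j, [/\ i < j, i \notin A & j \notin A].
Proof.
move=> An; have : 1 < #|~: A| by rewrite cardsCs setCK card_ord; lia.
case/card_gt1P=> i [j [+ + ij]]; rewrite !in_setC => iA jA.
case: (ltngtP i j) => [lt|lt|/val_inj e]; [by exists i, j|by exists j, i|].
by rewrite e eqxx in ij.
Qed.

Lemma between_neq u i v : u < i < v -> u != v.
Proof. by case/andP=> ui iv; rewrite -val_eqE /= ltn_eqF // (ltn_trans ui). Qed.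

Lemma between_gtF u i v : u < i < v -> (v < u) = false.
Proof. by case/andP=> ui iv; rewrite ltnNge (ltnW (ltn_trans ui iv)). Qed.

Lemma card_initial (m : nat) : m <= n -> #|[set i : 'I_n | i < m]| = m.
Proof.
move=> mn; rewrite -sum1_card (eq_bigl (fun i : 'I_n => i < m)) => [|i]; last by rewrite inE.
by rewrite -(big_ord_widen n (fun=> 1) mn) sum1_card card_ord.
Qed.

(** * Projections without unnested singletons, two ranks down *)

Section Tight.

Variables (d : nat) (p : diagram n).
Hypotheses (dn : d + 4 <= n) (subB : projections n d.+2 \subset B).
Hypothesis loose_B : forall q i, q \in projections n d -> partner q (upper i) = upper i ->
  unnested q i -> q \in B.
Hypotheses (pJ : p \in projections n d).
Hypothesis tight : forall i, partner p (upper i) = upper i -> ~ unnested p i.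

Lemma tight_hook : exists a b : 'I_n,
  [/\ a < b, partner p (upper a) = upper b, unnested p a & unnested p b].
Proof.
have /projectionsP[pN sym rk] := pJ; have pP := nc_pb pN.
have [|x0 [_ [_ x0D _]]] := @set_subset_card (ddom p); first by rewrite rk; lia.
have [x xD [xU _]] := exists_unnested pP x0D.
have xy := mate_upper pP xD; set y := mate p x in xy.
have yx := partner_swap pP xy.
have yU : unnested p y.
  move=> u v uv; apply/negP=> uyv; have [w yw uwv] := upper_hook_inside pN uv uyv.
  by move: yw uwv; rewrite yx => -[<-]; apply/negP/xU.
case: (ltngtP x y) => [lt|lt|/val_inj e]; [by exists x, y|by exists y, x|].
by case: (@tight x) => //; rewrite xy -e.
Qed.

(* Let [p1] be [p] with an outermost hook [{a, b}] opened into two transversals, and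
   let [al] map the domain of [p1] onto an initial segment.  If [be] is the identity on
   that segment except for a hook joining the images of [a] and [b], then
   [p = al be al*], and the column after the segment is an unnested singleton of [be]. *)
Lemma tight_projection_mem : p \in B.
Proof.
have [dn2 h2 h3] : [/\ d.+2 + 2 <= n, d.+2 < n & d.+3 < n] by split; lia.
have d2n := ltnW h2.
have /projectionsP[pN sym rk] := pJ; have pP := nc_pb pN.
have [a [b [ab hab aU bU]]] := tight_hook.
have hba := partner_swap pP hab.
have aD : a \notin ddom p by apply/(not_ddomP _ pP); exists b.
have bD : b \notin ddom p by apply/(not_ddomP _ pP); exists a.
have nab : b != a by rewrite -val_eqE /= gtn_eqF.
have ma : mate p a = b by rewrite /mate hab.
set p0 := open_at p a; have p0N : p0 \in nc_monoid n := open_nc pN sym aU.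
have p0P := nc_pb p0N; have sym0 : dstar p0 = p0 := open_star a pN sym.
have dom0 : ddom p0 = a |: ddom p := open_dom a pN sym.
have bD0 : b \notin ddom p0 by rewrite dom0 in_setU1 negb_or nab.
have p0b : partner p0 (upper b) = upper b by apply: open_singleton => //; left.
have mb : mate p0 b = b by rewrite /mate p0b.
have bU0 : unnested p0 b.
  move=> u v uv; apply/negP=> ubv; move: (ubv); apply/negP/bU.
  by apply: (open_hook pN sym uv); apply: between_neq ubv.
set p1 := open_at p0 b; have p1N : p1 \in nc_monoid n := open_nc p0N sym0 bU0.
have p1P := nc_pb p1N; have sym1 : dstar p1 = p1 := open_star b p0N sym0.
have dom1 : ddom p1 = b |: (a |: ddom p) by rewrite open_dom ?dom0.
have keep i : i \notin ddom p -> i != a -> i != b ->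
    partner p1 (upper i) = partner p (upper i).
  move=> iD ia ib; rewrite open_keep ?mb ?open_keep ?ma //.
  by rewrite dom0 in_setU1 negb_or ia.
have rk0 : #|ddom p0| = d.+1 by rewrite dom0 cardsU1 aD rk.
have rk1 : #|ddom p1| = d.+2 by rewrite dom1 cardsU1 -dom0 bD0 rk0.
have p1B : p1 \in B.
  by apply: (subsetP subB); rewrite -rk0; apply: open_projections.
have not1 i : i \notin ddom p1 -> [/\ i \notin ddom p, i != a & i != b].
  by rewrite dom1 !in_setU1 !negb_or => /and3P[ib ia iD].
have inside i : a < i < b -> i \notin ddom p1.
  move=> aib; have [l il _] := upper_hook_inside pN hab aib.
  apply/(not_ddomP _ p1P); exists l; rewrite keep //.
  - by apply/(not_ddomP _ pP); exists l.
  - by case/andP: aib => ai _; rewrite -val_eqE /= gtn_eqF.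
  - by case/andP: aib => _ ib; rewrite -val_eqE /= ltn_eqF.
(* Otherwise the blocks at the free columns of [p1] would be singletons, all under the hook of [a]
   and [b] by tightness. There are at least two such columns, and every column between [a] and [b]
   is free, so two free columns would be adjacent. *)
have nc1 : ~~ cosparse (ddom p1).
  apply/negP=> cos; have single i : i \notin ddom p1 -> partner p (upper i) = upper i.
    by move=> i1; have [iD ia ib] := not1 i i1; rewrite -keep // cosparse_upper.
  have between_ab i : i \notin ddom p1 -> a < i < b.
    move=> i1; apply: contraT => aib; case: (@tight i (single i i1)) => u v uv.
    apply: contraT; rewrite negbK => uiv; have uD : u \notin ddom p by apply/(not_ddomP _ pP); exists v.
    have nuv := between_neq uiv.
    case: (eqVneq u a) => [ua|ua].
      by move: uv uiv aib; rewrite ua hab => -[<-] ->.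
    case: (eqVneq u b) => [ub|ub].
      by move: uv; rewrite ub hba => -[av]; have := between_gtF uiv; rewrite ub -av ab.
    have u1 : u \notin ddom p1 by rewrite dom1 !in_setU1 !negb_or ub ua.
    by move: uv; rewrite (single u u1) => -[e]; rewrite e eqxx in nuv.
  have [|i [j [ij i1 j1]]] := @set_subset_card (ddom p1); first by rewrite rk1.
  have /andP[ai ib] := between_ab i i1; have /andP[aj jb] := between_ab j j1.
  have i1n : i.+1 < n by apply: leq_ltn_trans ij (ltn_ord j).
  suff : ~~ cosparse (ddom p1) by rewrite cos.
  apply/not_cosparseP; exists i, (Ordinal i1n); split=> //.
  by apply: inside; rewrite /= (ltn_trans ai) ?ltnSn // (leq_ltn_trans ij).
pose I := [set i : 'I_n | i < d.+2].
have rkI : #|I| = d.+2 by apply: card_initial.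
have ncI : ~~ cosparse I.
  by apply/not_cosparseP; exists (Ordinal h2), (Ordinal h3); rewrite !inE /= ltnn ltnNge leqnSn.
have [g [gB gN dg cg]] := linked_noncosparse B_closed subB rk1 rkI nc1 ncI.
have gP := nc_pb gN.
have [dal cal] := dom_dmul_codom p1P gP (etrans (symmetric_codom p1P sym1) (esym dg)).
have alB : dmul p1 g \in B by apply: B_mul.
have alN : dmul p1 g \in nc_monoid n := nc_dmul p1N gN.
have alU i k : partner p1 (upper i) = upper k -> partner (dmul p1 g) (upper i) = upper k.
  exact: dmul_upper.
rewrite cg in cal; set al := dmul p1 g in dal cal alB alN alU.
have alP := nc_pb alN; have salP := star_pb alP.
(* [B] is not known to be closed under [dstar], but at rank [d + 2] it contains all elements with
   noncosparse domain and codomain. *)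
have salB : dstar al \in B.
  apply: (noncosparse_mem B_closed subB (nc_star alN)).
  - by rewrite (dom_star alP) cal.
  - by rewrite (dom_star alP) cal.
  - by rewrite (codom_star alP) dal.
have sal_lower i k : partner al (upper i) = lower k -> partner (dstar al) (lower i) = upper k.
  by move=> e; rewrite (partner_star (lower i) alP) /= e.
have sal_upper i k : partner al (upper i) = lower k -> partner (dstar al) (upper k) = lower i.
  by move=> e; apply: (partner_swap salP); apply: sal_lower.
have sal_hook i k : partner al (upper i) = upper k -> partner (dstar al) (lower i) = lower k.
  by move=> e; rewrite (partner_star (lower i) alP) /= e.
have [j aj jI] : exists2 j, partner al (upper a) = lower j & j \in I.
  by rewrite -cal; apply: partner_dom; rewrite // dal dom1 !inE eqxx orbT.
have [l bl lI] : exists2 l, partner al (upper b) = lower l & l \in I.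
  by rewrite -cal; apply: partner_dom; rewrite // dal dom1 !inE eqxx.
have jl : j < l by rewrite -(transversal_mono alN aj bl).
pose D := I :\ j :\ l.
(* No transversal of [p1] starts between [a] and [b], and [al] preserves the order, so no element of
   [I] lies strictly between [j] and [l]. *)
have Djl k : j <= k <= l -> k \notin D.
  case/andP=> jk kl; rewrite !in_setD1; apply/negP=> /and3P[kl' kj kI].
  rewrite -cal in kI; have [i ik i1] := partner_codom alP kI.
  have : i \notin ddom p1.
    apply: inside; rewrite (transversal_mono alN aj ik) (transversal_mono alN ik bl).
    by rewrite !ltn_neqAle jk kl -!val_eqE /= in kl' kj *; rewrite kl' eq_sym kj.
  by rewrite -dal i1.
have nlj : l != j by rewrite -val_eqE /= gtn_eqF.
have rkD : #|D| = d.
  have := cardsD1 j I; rewrite jI rkI add1n => -[] /esym e.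
  by have := cardsD1 l (I :\ j); rewrite in_setD1 nlj lI e add1n => -[] /esym.
have beJ : hook_pattern D j l \in projections n d by apply: hook_pattern_projections.
have beU := hook_pattern_upper jl Djl.
have beB : hook_pattern D j l \in B.
  have notI k : k \in I -> Ordinal h2 != k.
    by rewrite inE => kd; rewrite -val_eqE /= gtn_eqF.
  apply: (loose_B (i := Ordinal h2) beJ).
    rewrite beU tpermD; [|by rewrite eq_sym notI|by rewrite eq_sym notI].
    by rewrite !in_setD1 !inE /= ltnn !andbF.
  move=> u v; rewrite beU; case: ifP => // _ [uv]; apply/negP=> /andP[u2 v2].
  move: uv v2 u2; case: tpermP => [-> <-|-> <-|_ _ ->].
  - by move: lI; rewrite inE /= => /ltnW; rewrite leqNgt => /negbTE ->.
  - by move: jI; rewrite inE /= => /ltnW; rewrite leqNgt => /negbTE ->.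
  - by move=> v2 u2; have := ltn_trans u2 v2; rewrite ltnn.
have beN : hook_pattern D j l \in nc_monoid n by case/projectionsP: beJ.
have beP := nc_pb beN; have sbe := hook_pattern_star jl Djl.
set be := hook_pattern D j l in beJ beU beB beN beP sbe.
have be_j : partner be (upper j) = upper l.
  by rewrite beU tpermL (negPf (Djl _ _)) // leqnn ltnW.
have be_l := partner_swap beP be_j.
have be_j' : partner be (lower j) = lower l by rewrite (symmetric_lower (upper j) beP sbe) be_j.
have be_l' := partner_swap beP be_j'.
have abP := dmul_pb alP beP.
have -> : p = dmul (dmul al be) (dstar al).
  apply: (eq_nc_sub pN (nc_dmul (nc_dmul alN beN) (nc_star alN))).
  - apply/subsetP=> -[i k] /upper_hooksP ik; apply/upper_hooksP.
    apply: (dmul_upper abP salP).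
    have iD : i \notin ddom p by apply/(not_ddomP _ pP); exists k.
    case: (eqVneq i a) ik => [->|ia ik].
      by rewrite hab => -[<-]; apply: (dmul_hook alP beP aj be_j (partner_swap alP bl)).
    case: (eqVneq i b) ik => [->|ib ik].
      by rewrite hba => -[<-]; apply: (dmul_hook alP beP bl be_l (partner_swap alP aj)).
    by apply: (dmul_upper alP beP); apply: alU; rewrite keep.
  - rewrite (symmetric_hooks pP sym); apply/subsetP=> -[i k] /upper_hooksP ik.
    have iD : i \notin ddom p by apply/(not_ddomP _ pP); exists k.
    apply/lower_hooksP; case: (eqVneq i a) ik => [->|ia ik].
      rewrite hab => -[<-].
      apply: (dmul_lower_hook abP salP (sal_lower _ _ aj) _ (sal_upper _ _ bl)).
      exact: (dmul_lower alP beP).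
    case: (eqVneq i b) ik => [->|ib ik].
      rewrite hba => -[<-].
      apply: (dmul_lower_hook abP salP (sal_lower _ _ bl) _ (sal_upper _ _ aj)).
      exact: (dmul_lower alP beP).
    by apply: (dmul_lower abP salP); apply: sal_hook; apply: alU; rewrite keep.
  apply/subset_leq_card/subsetP=> i iD.
  have [m im mI] : exists2 m, partner al (upper i) = lower m & m \in I.
    by rewrite -cal; apply: partner_dom; rewrite // dal dom1 !in_setU1 iD !orbT.
  have mD : m \in D.
    rewrite !in_setD1 mI andbT; apply/andP; split.
      apply: contraTneq iD => e; move: (partner_swap alP im).
      by rewrite e (partner_swap alP bl) => -[<-].
    apply: contraTneq iD => e; move: (partner_swap alP im).
    by rewrite e (partner_swap alP aj) => -[<-].
  apply/(ddomP _ (dmul_pb abP salP)); exists i.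
  apply: (dmul_transversal abP salP (dmul_transversal alP beP im _) (sal_upper _ _ im)).
  by rewrite beU mD.
exact: (B_mul (B_mul alB beB) salB).
Qed.

End Tight.

Variable r : nat.
Hypotheses (r_gt0 : 0 < r) (r_le : r + 2 <= n) (GB : E_generators n r \subset B).

(** Induction on [t = r - d]. An unnested singleton reduces [p] to rank [d + 1]. Without one, [p] is
    a generator if [t = 1] and comes from rank [d + 2] if [t >= 2], where [r + 2 <= n] gives
    [d + 4 <= n]. *)
Lemma projections_mem d : d <= r -> projections n d \subset B.
Proof.
move=> dr; rewrite -(subKn dr); move: (r - d) (leq_subr d r) => {d dr} t.
elim/ltn_ind: t => -[_ _|t IH tr].
  by rewrite subn0; apply: subset_trans GB; apply: subsetUl.
have rt : (r - t.+1).+1 = r - t by lia.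
have rtn : r - t.+1 + 2 <= n by lia.
have subt : projections n (r - t.+1).+1 \subset B by rewrite rt; apply: IH; lia.
have loose q i : q \in projections n (r - t.+1) -> partner q (upper i) = upper i ->
    unnested q i -> q \in B by exact: (loose_projection_mem subt rtn).
apply/subsetP=> p pJ; have /projectionsP[pN sym _] := pJ.
have [[i [ii iU]]|tight] := EM (exists i, partner p (upper i) = upper i /\ unnested p i).
  exact: loose pJ ii iU.
case: t => [|t] in IH tr rt rtn subt loose pJ *.
  apply: (subsetP GB); apply/setUP; right; apply/setIdP; split; first by rewrite -subn1.
  apply/no_unnestedP => // i ii; apply: contrapT => none; apply: tight; exists i; split=> // u v uv.
  by apply/negP=> uiv; apply: none; exists u, v.
apply: (tight_projection_mem (d := r - t.+2)) => //; first by lia.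
  have -> : (r - t.+2).+2 = r - t by lia.
  by apply: IH; lia.
by move=> i ii iU; apply: tight; exists i.
Qed.

Lemma E_set_mem : E_set n r \subset B.
Proof.
apply/subsetP=> a /E_setP[aN ra [[nd nc]|[_ ->]]].
  exact: (noncosparse_mem B_closed (projections_mem ra) aN erefl nd nc).
apply: (subsetP (projections_mem ra)); apply/projectionsP.
rewrite partial_id_dom partial_id_star; split=> //; exact: partial_id_nc.
Qed.

End Generation.

Lemma generated_E_generators n r : 0 < r -> r + 2 <= n ->
  generated (@dmul n) (E_generators n r) = E_set n r.
Proof.
move=> r0 rn; apply/eqP; rewrite eqEsubset.
rewrite (generated_min (E_generators_sub n r) (E_set_closed n r)) /=.
exact: (E_set_mem (generated_closed _ _) r0 rn (sub_generated _ _)).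
Qed.

Lemma motzkin_IE (R : realType) n r a :
  (a \in motzkin_I R n r) = (a \in nc_monoid n) && (#|ddom a| <= r).
Proof.
by rewrite /motzkin_I motzkinE in_set; apply: andb_id2l => aN; rewrite drankE ?nc_pb.
Qed.

Lemma mem_idempotents (R : realType) n r a :
  (a \in idempotents (@dmul n) (motzkin_I R n r)) =
  [&& a \in nc_monoid n, #|ddom a| <= r & dmul a a == a].
Proof. by rewrite in_set motzkin_IE andbA. Qed.

Lemma E_generators_idempotent (R : realType) n r :
  E_generators n r \subset idempotents (@dmul n) (motzkin_I R n r).
Proof.
have sub d : d <= r -> projections n d \subset idempotents (@dmul n) (motzkin_I R n r).
  move=> dr; apply/subsetP=> p /projectionsP[pN sym rk].
  by rewrite mem_idempotents pN rk dr (symmetric_idempotent pN sym) eqxx.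
rewrite subUset sub //=; apply: subset_trans (sub _ (leq_pred r)).
by apply/subsetP=> p /setIdP[].
Qed.

Lemma motzkin_E_set (R : realType) n r : 0 < r -> r + 2 <= n ->
  motzkin_E R n r = E_set n r.
Proof.
move=> r0 rn; apply/eqP; rewrite eqEsubset; apply/andP; split.
  apply: generated_min (E_set_closed n r); apply/subsetP=> a.
  rewrite mem_idempotents => /and3P[aN ra /eqP aa].
  exact: idempotent_E_set.
rewrite -(generated_E_generators r0 rn).
apply: generated_min (generated_closed _ _).
exact: subset_trans (E_generators_idempotent R n r) (sub_generated _ _).
Qed.

Theorem theorem4p16 (R : realType) (n r : nat) (r_gt0 : 1 <= r)
    (r_le : r + 2 <= n) :
  motzkin_E R n r =
      [set did A | A : {set 'I_n} & cosparse A && (#|A| <= r)]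
  :|: [set a in motzkin_I R n r | ~~ cosparse (ddom a) & ~~ cosparse (dcodom a)]
  /\ is_rank (@dmul n) (motzkin_E R n r)
       (num_Rclasses R n r + num_projections R n r.-1)
  /\ is_idrank (@dmul n) (motzkin_E R n r)
       (num_Rclasses R n r + num_projections R n r.-1).
Proof.
rewrite num_RclassesE num_projectionsE -(card_E_generators n r_gt0).
have EE := motzkin_E_set R r_gt0 r_le; have gen := generated_E_generators r_gt0 r_le.
split; [|rewrite EE; split; split].
- rewrite EE /E_set; congr (_ :|: _); apply/setP=> a.
  by rewrite [LHS]in_set [RHS]in_set motzkin_IE andbA.
- by exists (E_generators n r).
- by move=> A; apply: leq_card_E_generators.
- exists (E_generators n r) => //; split=> //; rewrite -EE.
  apply/subsetP=> p pG.
  have := subsetP (E_generators_idempotent R n r) _ pG.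
  rewrite mem_idempotents => /and3P[_ _ pp]; apply/setIdP; split; last exact: pp.
  by rewrite EE; apply: (subsetP (E_generators_sub n r)).
- by move=> A [_]; apply: leq_card_E_generators.
Qed.
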